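(* Let $\ell_p$ denote the maximum length of the preference list of any program. The min-sum problem (given an instance as described in the context, compute an $\mathcal{A}$-perfect stable matching $M$ minimizing $\sum_{p\in\mathcal{B}}|M(p)|\cdot c(p)$) admits (I) a linear-time $\ell_p$-approximation algorithm, and (II) a $|\mathcal{B}|$-approximation algorithm.
   Context: An instance consists of a bipartite graph $G=(\mathcal{A}\cup\mathcal{B},E)$, where $\mathcal{A}$ is a set of agents, $\mathcal{B}$ a set of programs, and $(a,p)\in E$ iff $a$ and $p$ are mutually acceptable. Each agent ranks its neighbours in a strict order and each program ranks its neighbours in a strict order; $y>_x z$ means $x$ prefers $y$ to $z$. Each program $p$ has a non-negative integer cost $c(p)$; programs have no quotas. A matching $M\subseteq E$ assigns each agent to at most one program (a program may receive any number of agents); $M(a)$ is the program of $a$ and $M(p)$ the set of agents assigned to $p$. An agent prefers any acceptable program to being unmatched. A pair $(a,p)\in E\setminus M$ blocks $M$ if $p>_a M(a)$ and there is $a'\in M(p)$ with $a>_p a'$; $M$ is stable if no pair blocks it. $M$ is $\mathcal{A}$-perfect if every agent is matched. An $\alpha$-approximation algorithm outputs an $\mathcal{A}$-perfect stable matching whose total cost is at most $\alpha$ times the optimum. *)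

(* Defs.v *)
From mathcomp Require Import all_boot.
Set Implicit Arguments.
Unset Strict Implicit.
Unset Printing Implicit Defensive.

(** * Instances, matchings, stability *)

(* Agents are 'I_nA and programs 'I_nB.  A strict ranking of the neighbours of
   a vertex is a duplicate-free list, most preferred first; [pref_sym] says
   that the two families of lists describe the same bipartite graph. *)
Record instance := Instance {
  nA : nat;
  nB : nat;
  agent_pref : 'I_nA -> seq 'I_nB;
  prog_pref : 'I_nB -> seq 'I_nA;
  cost : 'I_nB -> nat;
  agent_pref_uniq : forall a, uniq (agent_pref a);
  prog_pref_uniq : forall p, uniq (prog_pref p);
  pref_sym : forall a p, (p \in agent_pref a) = (a \in prog_pref p)
}.

(* [y] is ranked strictly before [z] in [s]; a [z] absent from [s] comes last. *)
Definition ranked_before (T : eqType) (s : seq T) (y z : T) : bool :=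
  index y s < index z s.

Section Matchings.
Variable I : instance.

Definition agent := 'I_(nA I).
Definition program := 'I_(nB I).

Definition edges : {set agent * program} :=
  [set e | e.2 \in agent_pref e.1].

Definition is_matching (M : {set agent * program}) : Prop :=
  M \subset edges /\
  forall a p q, (a, p) \in M -> (a, q) \in M -> p = q.

(* M(a), with [None] for an unmatched agent, and M(p). *)
Definition program_of (M : {set agent * program}) (a : agent) : option program :=
  [pick p | (a, p) \in M].

Definition agents_of (M : {set agent * program}) (p : program) : {set agent} :=
  [set a | (a, p) \in M].

Definition agent_prefers (a : agent) (p : program) (o : option program) : bool :=
  if o is Some q then ranked_before (agent_pref a) p q
  else p \in agent_pref a.

Definition blocks (M : {set agent * program}) (a : agent) (p : program) : Prop :=
  [/\ (a, p) \in edges :\: M,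
      agent_prefers a p (program_of M a)
    & exists2 a', a' \in agents_of M p & ranked_before (prog_pref p) a a'].

Definition stable (M : {set agent * program}) : Prop :=
  forall a p, ~ blocks M a p.

Definition agent_perfect (M : {set agent * program}) : Prop :=
  forall a, exists p, (a, p) \in M.

Definition feasible (M : {set agent * program}) : Prop :=
  [/\ is_matching M, stable M & agent_perfect M].

Definition total_cost (M : {set agent * program}) : nat :=
  \sum_(p : program) #|agents_of M p| * cost p.

Definition optimal (M : {set agent * program}) : Prop :=
  feasible M /\ forall N, feasible N -> total_cost M <= total_cost N.

Definition max_prog_pref : nat := \max_(p : program) size (prog_pref p).

End Matchings.

(** * A word RAM *)

(* Structured programs over finitely many word registers and finitely many
   word arrays (both indexed by naturals).  Every node of an expression and
   every executed command costs one time unit. *)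
Inductive binop := Add | Sub | Mul | Div | Lt | Eq.

Inductive expr :=
  | Cst of nat
  | Reg of nat
  | Get of nat & expr                  (* Get k i : cell i of array k *)
  | Bin of binop & expr & expr.

Inductive cmd :=
  | Skip
  | Assign of nat & expr
  | Store of nat & expr & expr          (* Store k i e : cell i of array k := e *)
  | Seq of cmd & cmd
  | If of expr & cmd & cmd
  | While of expr & cmd.

Record state := State { reg : nat -> nat; arr : nat -> nat -> nat }.

Definition upd (T : Type) (f : nat -> T) (k : nat) (v : T) : nat -> T :=
  fun j => if j == k then v else f j.

Definition set_reg (s : state) (x v : nat) : state :=
  State (upd (reg s) x v) (arr s).

Definition set_cell (s : state) (k i v : nat) : state :=
  State (reg s) (upd (arr s) k (upd (arr s k) i v)).

(* [Sub] is truncated, and division by zero returns zero. *)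
Definition binop_fun (o : binop) (m n : nat) : nat :=
  match o with
  | Add => m + n
  | Sub => m - n
  | Mul => m * n
  | Div => m %/ n
  | Lt => m < n
  | Eq => m == n
  end.

(* Words are the naturals below [W]; a computation that produces a larger
   value is stuck.  Contents of the memory need no check: the input fits in
   words and only results of [eval] are ever written. *)
Definition word (W n : nat) : option nat := if n < W then Some n else None.

Fixpoint eval (W : nat) (s : state) (e : expr) : option nat :=
  match e with
  | Cst n => word W n
  | Reg x => Some (reg s x)
  | Get k e1 => if eval W s e1 is Some i then Some (arr s k i) else None
  | Bin o e1 e2 =>
      if eval W s e1 is Some m then
        if eval W s e2 is Some n then word W (binop_fun o m n) else None
      else None
  end.

Fixpoint expr_time (e : expr) : nat :=
  match e with
  | Cst _ | Reg _ => 1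
  | Get _ e1 => (expr_time e1).+1
  | Bin _ e1 e2 => (expr_time e1 + expr_time e2).+1
  end.

(* [exec W c s t s'] : with words below [W], command [c] started in [s] halts
   in [s'] after exactly [t] time units. *)
Inductive exec (W : nat) : cmd -> state -> nat -> state -> Prop :=
  | ExecSkip s : exec W Skip s 1 s
  | ExecAssign s x e v :
      eval W s e = Some v ->
      exec W (Assign x e) s (expr_time e).+1 (set_reg s x v)
  | ExecStore s k e1 e2 i v :
      eval W s e1 = Some i -> eval W s e2 = Some v ->
      exec W (Store k e1 e2) s (expr_time e1 + expr_time e2).+1
        (set_cell s k i v)
  | ExecSeq s s1 s2 c1 c2 t1 t2 :
      exec W c1 s t1 s1 -> exec W c2 s1 t2 s2 ->
      exec W (Seq c1 c2) s (t1 + t2).+1 s2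
  | ExecIf s s1 e c1 c2 v t :
      eval W s e = Some v -> exec W (if v != 0 then c1 else c2) s t s1 ->
      exec W (If e c1 c2) s (expr_time e + t).+1 s1
  | ExecWhileEnd s e c :
      eval W s e = Some 0 ->
      exec W (While e c) s (expr_time e).+1 s
  | ExecWhileStep s s1 s2 e c v t1 t2 :
      eval W s e = Some v -> v != 0 ->
      exec W c s t1 s1 -> exec W (While e c) s1 t2 s2 ->
      exec W (While e c) s (expr_time e + t1 + t2).+1 s2.

(** * Algorithms on instances *)

Definition encode_list (n : nat) (s : seq 'I_n) : seq nat :=
  size s :: [seq val i | i <- s].

(* The two cardinalities, the costs, then the preference lists of the agents
   and of the programs, each preceded by its length. *)
Definition encode (I : instance) : seq nat :=
  [:: nA I; nB I]
    ++ [seq cost p | p : 'I_(nB I)]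
    ++ flatten [seq encode_list (agent_pref a) | a : 'I_(nA I)]
    ++ flatten [seq encode_list (prog_pref p) | p : 'I_(nB I)].

(* Input in array 0, everything else zero. *)
Definition initial_state (I : instance) : state :=
  State (fun _ => 0) (fun k => if k == 0 then nth 0 (encode I) else fun _ => 0).

(* Output in array 1: cell [a] holds the number of the program of agent [a],
   and any value that is not a program leaves [a] unmatched. *)
Definition output (I : instance) (s : state) : {set agent I * program I} :=
  [set e | arr s 1 (val e.1) == val e.2].

(* Number of input words: up to constant factors |A| + |B| + |E|. *)
Definition input_size (I : instance) : nat := size (encode I).

Definition input_bits (I : instance) : nat :=
  \sum_(x <- encode I) (trunc_log 2 x).+1.

(* Words of O(log N) bits, where N is the input size plus the largest number
   in the input. *)
Definition word_bound (K : nat) (I : instance) : nat :=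
  K * (input_size I + \max_(x <- encode I) x) ^ K.

(* Halts on every instance within the time bound; the approximation guarantee
   concerns the instances that have a feasible solution at all. *)
Definition approximates (c : cmd) (alpha W T : instance -> nat) : Prop :=
  forall I, exists t s,
    [/\ exec (W I) c (initial_state I) t s,
        t <= T I
      & forall Mopt : {set agent I * program I}, optimal Mopt ->
          feasible (output I s) /\
          total_cost (output I s) <= alpha I * total_cost Mopt].

Definition has_linear_time_approximation (alpha : instance -> nat) : Prop :=
  exists (c : cmd) (K : nat),
    approximates c alpha (word_bound K) (fun I => K * input_size I).

Definition has_poly_time_approximation (alpha : instance -> nat) : Prop :=
  exists (c : cmd) (K : nat),
    approximates c alpha (word_bound K) (fun I => K * input_bits I ^ K).

(* Main.v *)
Require Import Defs.
From mathcomp Require Import all_boot.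
From mathcomp Require Import zify.
Set Implicit Arguments.
Unset Strict Implicit.
Unset Printing Implicit Defensive.

(** Linear time: let S be the set of the programs that are cheapest for some
    agent, and give every agent its favourite program in S.  Programs outside S
    are empty, so nothing blocks.  Each program p in use is cheapest for some
    agent, whose cost in any solution is at least c(p), and p receives at most
    l_p agents.

    Factor |B|: minimise the maximum load max_p |M(p)| c(p) instead; the optimum
    L of that problem is at most the minimum total cost, and the solution found
    costs at most |B| L.  All agents start at their first choice.  As long as
    nobody has run out of programs, the worst agent of a program of maximum load
    moves on to its next choice, and the assignment is saved whenever its maximum
    load beats the best one so far.  A solution of load below the current best
    never assigns an agent to a program that it has already left, as in the
    analysis of deferred acceptance. *)

(** * Total correctness with time bounds *)

(** Value and overflow are separated: [den] is total, and [fits] collects the bounds under which the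
    partial [eval] returns that value. *)
Fixpoint den (s : state) (e : expr) : nat :=
  match e with
  | Cst n => n
  | Reg x => reg s x
  | Get k e1 => arr s k (den s e1)
  | Bin o e1 e2 => binop_fun o (den s e1) (den s e2)
  end.

Fixpoint fits (W : nat) (s : state) (e : expr) : Prop :=
  match e with
  | Cst n => n < W
  | Reg _ => True
  | Get _ e1 => fits W s e1
  | Bin o e1 e2 =>
      [/\ fits W s e1, fits W s e2 & binop_fun o (den s e1) (den s e2) < W]
  end.

Lemma eval_den W s e : fits W s e -> eval W s e = Some (den s e).
Proof.
elim: e => [n|x|k e IH|o e1 IH1 e2 IH2] //=; rewrite /word.
- by move=> ->.
- by move=> /IH ->.
- by case=> /IH1 -> /IH2 -> ->.
Qed.

Fixpoint wregs (c : cmd) : seq nat :=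
  match c with
  | Skip | Store _ _ _ => [::]
  | Assign x _ => [:: x]
  | Seq c1 c2 | If _ c1 c2 => wregs c1 ++ wregs c2
  | While _ c1 => wregs c1
  end.

Fixpoint warrs (c : cmd) : seq nat :=
  match c with
  | Skip | Assign _ _ => [::]
  | Store k _ _ => [:: k]
  | Seq c1 c2 | If _ c1 c2 => warrs c1 ++ warrs c2
  | While _ c1 => warrs c1
  end.

Definition frame (c : cmd) (s s' : state) : Prop :=
  (forall x, x \notin wregs c -> reg s' x = reg s x) /\
  (forall k, k \notin warrs c -> arr s' k = arr s k).

Lemma exec_frame W c s t s' : exec W c s t s' -> frame c s s'.
Proof.
elim=> {c s t s'} [s|s x e v _|s k e1 e2 i v _ _|s s1 s2 c1 c2 t1 t2 _ [r1 a1] _ [r2 a2]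
  |s s1 e c1 c2 v t _ _ [r a]|s e c _|s s1 s2 e c v t1 t2 _ _ _ [r1 a1] _ [r2 a2]];
  split=> y //=; rewrite ?inE ?mem_cat ?negb_or.
- by rewrite /upd => /negPf ->.
- by rewrite /upd => /negPf ->.
- by case/andP=> h1 h2; rewrite r2 // r1.
- by case/andP=> h1 h2; rewrite a2 // a1.
- by case/andP=> h1 h2; apply: r; case: ifP.
- by case/andP=> h1 h2; apply: a; case: ifP.
- by move=> h; rewrite r2 // r1.
- by move=> h; rewrite a2 // a1.
Qed.

(** [T] only bounds the time from above, so bounds compose and can be rounded up. *)
Definition wp (W : nat) (c : cmd) (s : state) (T : nat) (Q : state -> Prop) :=
  exists t s', [/\ exec W c s t s', t <= T & Q s'].

Lemma wp_weaken W c s T T' (Q Q' : state -> Prop) :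
  wp W c s T Q -> T <= T' -> (forall s', Q s' -> Q' s') -> wp W c s T' Q'.
Proof.
move=> [t [s' [h1 h2 h3]]] hT hQ; exists t, s'; split=> //.
  exact: leq_trans hT.
exact: hQ.
Qed.

Lemma wp_leq W c s T T' (Q : state -> Prop) : T <= T' -> wp W c s T Q -> wp W c s T' Q.
Proof. by move=> hT h; apply: wp_weaken h hT _. Qed.

Lemma wp_frame W c s T (Q : state -> Prop) :
  wp W c s T Q -> wp W c s T (fun s' => Q s' /\ frame c s s').
Proof.
by move=> [t [s' [h1 h2 h3]]]; exists t, s'; split=> //; split=> //; apply: exec_frame h1.
Qed.

Lemma wp_seq W c1 c2 s T1 T2 Q :
  wp W c1 s T1 (fun s1 => wp W c2 s1 T2 Q) -> wp W (Seq c1 c2) s (T1 + T2).+1 Q.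
Proof.
move=> [t1 [s1 [h1 l1 [t2 [s2 [h2 l2 q]]]]]]; exists (t1 + t2).+1, s2; split=> //.
  exact: ExecSeq h1 h2.
by rewrite ltnS leq_add.
Qed.

Lemma wp_while_end W e c s (Q : state -> Prop) :
  fits W s e -> den s e = 0 -> Q s -> wp W (While e c) s (expr_time e).+1 Q.
Proof.
move=> he h0 q; exists (expr_time e).+1, s; split=> //.
by apply: ExecWhileEnd; rewrite eval_den // h0.
Qed.

Lemma wp_while_step W e c s T1 T2 Q :
  fits W s e -> den s e != 0 -> wp W c s T1 (fun s1 => wp W (While e c) s1 T2 Q) ->
  wp W (While e c) s (expr_time e + T1 + T2).+1 Q.
Proof.
move=> he h0 [t1 [s1 [h1 l1 [t2 [s2 [h2 l2 q]]]]]].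
exists (expr_time e + t1 + t2).+1, s2; split=> //; last by rewrite ltnS !leq_add.
by apply: ExecWhileStep h1 h2; [apply: eval_den | ].
Qed.

Lemma wp_if W e c1 c2 s T Q : fits W s e ->
  (den s e != 0 -> wp W c1 s T Q) -> (den s e = 0 -> wp W c2 s T Q) ->
  wp W (If e c1 c2) s (expr_time e + T).+1 Q.
Proof.
move=> he h1 h2.
have [t [s1 [h l q]]] : wp W (if den s e != 0 then c1 else c2) s T Q.
  by case: eqP => [/h2|/eqP/h1].
exists (expr_time e + t).+1, s1; split=> //; last by rewrite ltnS leq_add2l.
exact: ExecIf (eval_den he) h.
Qed.

(** A weakest precondition for loop-free commands: simplifying it on a concrete command leaves the
    verification conditions. Loops get [False] and go through invariant rules instead. *)
Fixpoint sp (W : nat) (c : cmd) (s : state) (Q : state -> Prop) : Prop :=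
  match c with
  | Skip => Q s
  | Assign x e => fits W s e /\ Q (set_reg s x (den s e))
  | Store k e1 e2 =>
      [/\ fits W s e1, fits W s e2 & Q (set_cell s k (den s e1) (den s e2))]
  | Seq c1 c2 => sp W c1 s (fun s1 => sp W c2 s1 Q)
  | If e c1 c2 =>
      [/\ fits W s e, den s e != 0 -> sp W c1 s Q & den s e = 0 -> sp W c2 s Q]
  | While _ _ => False
  end.

(** Both branches of a conditional are charged. The value 0 for loops is harmless, since [sp] of a
    loop is [False]. *)
Fixpoint ctime (c : cmd) : nat :=
  match c with
  | Skip => 1
  | Assign _ e => (expr_time e).+1
  | Store _ e1 e2 => (expr_time e1 + expr_time e2).+1
  | Seq c1 c2 => (ctime c1 + ctime c2).+1
  | If e c1 c2 => (expr_time e + (ctime c1 + ctime c2)).+1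
  | While _ _ => 0
  end.

Lemma sp_wp W c s Q : sp W c s Q -> wp W c s (ctime c) Q.
Proof.
elim: c s Q => [|x e|k e1 e2|c1 IH1 c2 IH2|e c1 IH1 c2 IH2|e c IH] s Q //=.
- by move=> q; exists 1, s; split=> //; apply: ExecSkip.
- case=> he q; exists (expr_time e).+1, (set_reg s x (den s e)); split=> //.
  exact/ExecAssign/eval_den.
- case=> h1 h2 q; do 2!eexists; split; last exact: q.
    by apply: ExecStore; apply: eval_den.
  by [].
- move=> /IH1 h; apply: wp_seq; apply: wp_weaken h _ _ => // s1.
  exact: IH2.
- case=> he h1 h2; apply: wp_if => // h.
    by apply: wp_leq (IH1 _ _ (h1 h)); apply: leq_addr.
  by apply: wp_leq (IH2 _ _ (h2 h)); apply: leq_addl.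
Qed.

Definition for_loop (r : nat) (n : expr) (body : cmd) : cmd :=
  Seq (Assign r (Cst 0))
    (While (Bin Lt (Reg r) n)
       (Seq body (Assign r (Bin Add (Reg r) (Cst 1))))).

(** Each iteration pays [expr_time e + 8] for test, increment and sequencing; the last summands pay
    for the initialization and the failing test. [Inv] must tolerate changes of [r], which the loop
    itself writes. *)
Lemma wp_for W (r n : nat) e body (Inv : nat -> state -> Prop) (T : nat -> nat) s :
  1 < W -> n < W -> r \notin wregs body ->
  (forall i s v, Inv i s -> Inv i (set_reg s r v)) ->
  (forall i s, Inv i s -> fits W s e /\ den s e = n) ->
  (forall i s, i < n -> reg s r = i -> Inv i s -> wp W body s (T i) (Inv i.+1)) ->
  Inv 0 s ->
  wp W (for_loop r e body) s
    (\sum_(i < n) (T i + expr_time e + 8) + expr_time e + 6) (Inv n).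
Proof.
move=> W1 Wn hr hset he hbody h0.
pose loop := While (Bin Lt (Reg r) e) (Seq body (Assign r (Bin Add (Reg r) (Cst 1)))).
(* Induction on the number [k] of iterations left. *)
have step k : forall i s, i + k = n -> reg s r = i -> Inv i s ->
    wp W loop s (\sum_(i <= j < n) (T j + expr_time e + 8) + expr_time e + 3) (Inv n).
  elim: k => [|k IH] i s1 hik hi hI; have [fe de] := he _ _ hI.
    have {}hik : i = n by lia.
    rewrite hik big_geq //.
    apply: (wp_weaken (T := (expr_time (Bin Lt (Reg r) e)).+1) (Q := Inv n)) => //=.
      apply: wp_while_end => //=; first by split=> //; apply: leq_ltn_trans (leq_b1 _) W1.
        by rewrite de hi hik ltnn.
      by rewrite -{1}hik.
    by rewrite add0n -[_ + 3]addnC; lia.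
  have lin : i < n by lia.
  rewrite big_ltn //.
  apply: wp_weaken; first apply: (@wp_while_step _ _ _ _ (T i + 4 + 1)
     (\sum_(i.+1 <= j < n) (T j + expr_time e + 8) + expr_time e + 3) (Inv n)) => //=.
  - by split=> //; apply: leq_ltn_trans (leq_b1 _) W1.
  - by rewrite de hi lin.
  - apply: (@wp_weaken _ _ _ (T i + 4).+1 _ (fun s2 => wp W loop s2
       (\sum_(i.+1 <= j < n) (T j + expr_time e + 8) + expr_time e + 3) (Inv n))).
    + apply: wp_seq; apply: wp_weaken (wp_frame (hbody _ _ lin hi hI)) (leqnn _) _.
      move=> s2 [I2 [f2 _]]; have r2 : reg s2 r = i by rewrite f2.
      apply: (@sp_wp W (Assign r (Bin Add (Reg r) (Cst 1)))) => /=; rewrite r2.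
      split; first by split=> //; lia.
      apply: IH; [by lia| by rewrite /= /upd eqxx addn1 | exact: hset].
    + by lia.
    + by [].
  - by rewrite /=; lia.
  - by [].
apply: (@wp_weaken _ _ _
  (2 + (\sum_(i < n) (T i + expr_time e + 8) + expr_time e + 3)).+1 _ (Inv n)) => //.
  apply: wp_seq; apply: (@sp_wp W (Assign r (Cst 0))) => /=; split; first by lia.
  rewrite -(big_mkord xpredT (fun i => T i + expr_time e + 8)).
  by apply: (step n) => //; [rewrite /= /upd eqxx | apply: hset].
by lia.
Qed.

(** * Reading length-prefixed lists *)

(** Read addresses are specified by the suffix of the input that starts there; this yields the cell
    read and the next suffix. *)
Lemma drop_consE (T : Type) (x0 x : T) (s t : seq T) p :
  drop p s = x :: t -> [/\ nth x0 s p = x, drop p.+1 s = t & p < size s].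
Proof.
move=> h; have lt : p < size s by move: (size_drop p s); rewrite h /=; lia.
by move: h; rewrite (drop_nth x0 lt) => -[].
Qed.

Definition encl (xs : seq nat) : seq nat := size xs :: xs.

Lemma size_flatten_encl ls :
  size (flatten (map encl ls)) = \sum_(i < size ls) (size (nth [::] ls i)).+1.
Proof.
rewrite size_flatten sumnE /shape -map_comp big_map (big_nth [::]) big_mkord.
by apply: eq_bigr.
Qed.

(* [walk] reads consecutive length-prefixed lists of array 0.  Registers:
   0 is the index of the current list, 1 the read address, 2 the end address
   of the current list, 3 the current entry. *)
Definition scan (body : cmd) : cmd :=
  While (Bin Lt (Reg 1) (Reg 2))
    (Seq (Assign 3 (Get 0 (Reg 1)))
       (Seq body (Assign 1 (Bin Add (Reg 1) (Cst 1))))).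

Definition walk (n : expr) (pre body post : cmd) : cmd :=
  for_loop 0 n
    (Seq pre
       (Seq (Assign 2 (Bin Add (Bin Add (Reg 1) (Cst 1)) (Get 0 (Reg 1))))
          (Seq (Assign 1 (Bin Add (Reg 1) (Cst 1)))
             (Seq (scan body) post)))).

(** Registers 0 to 3 belong to the traversal and array 0 is the input. Conversely, [stable_regs]
    makes an invariant survive the traversal's own writes to these registers. *)
Definition clean (c : cmd) : bool :=
  all (fun r => r \notin wregs c) [:: 0; 1; 2; 3] && (0 \notin warrs c).

Definition stable_regs (P : state -> Prop) : Prop :=
  forall s r v, r \in [:: 0; 1; 2; 3] -> P s -> P (set_reg s r v).

Lemma clean_frame c s s' : clean c -> frame c s s' ->
  [/\ reg s' 0 = reg s 0, reg s' 1 = reg s 1, reg s' 2 = reg s 2 & arr s' 0 = arr s 0].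
Proof.
by case/andP=> /= /and4P [h0 h1 h2 _] ha [fr fa]; rewrite !fr // fa.
Qed.

(** Induction on the unread part [zs] of [l]; [J] is indexed by the part [xs] already read. *)
Lemma wp_scan W inp body i l rest (J : seq nat -> state -> Prop) zs xs s :
  (size inp).+1 < W -> clean body -> (forall xs, stable_regs (J xs)) ->
  (forall xs x ys s, l = xs ++ x :: ys -> reg s 3 = x -> reg s 0 = i ->
     arr s 0 = nth 0 inp -> J xs s -> sp W body s (J (rcons xs x))) ->
  l = xs ++ zs -> drop (reg s 1) inp = zs ++ rest ->
  reg s 2 = reg s 1 + size zs -> reg s 0 = i -> arr s 0 = nth 0 inp -> J xs s ->
  wp W (scan body) s ((ctime body + 16) * size zs + 4)
    (fun s' => J l s' /\ drop (reg s' 1) inp = rest).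
Proof.
move=> hW hc hJ hbody.
have W1 : 1 < W by lia.
have hb (b : bool) : b < W by apply: leq_ltn_trans (leq_b1 _) W1.
elim: zs xs s => [|z zs IH] xs s hl hd h2 h0 ha hx.
  apply: (wp_weaken (T := 4) (Q := fun s' => J l s' /\ drop (reg s' 1) inp = rest)) => //;
    last by rewrite leq_addl.
  apply: wp_while_end => //=; first by rewrite h2 addn0 ltnn.
  by rewrite hl cats0.
have [ez hd' lts] := drop_consE 0 hd.
apply: (wp_leq (T := (3 + (3 + (ctime body + 4).+1).+1 +
    ((ctime body + 16) * size zs + 4)).+1)); first by rewrite /=; lia.
apply: wp_while_step => //=; first by rewrite h2 /=; lia.
apply: wp_seq; apply: (@sp_wp W (Assign 3 (Get 0 (Reg 1)))) => /=; split=> //.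
rewrite ha ez; set s1 := set_reg s 3 z.
have hx1 : J xs s1 by apply: hJ.
have ha1 : arr s1 0 = nth 0 inp by [].
apply: wp_seq.
apply: wp_weaken (wp_frame (sp_wp (hbody xs z zs s1 hl _ h0 ha1 hx1))) (leqnn _) _ => //.
move=> s2 [hx2 f2]; have [r0 r1 r2 a0] := clean_frame hc f2.
apply: (@sp_wp W (Assign 1 (Bin Add (Reg 1) (Cst 1)))) => /=.
have e1 : reg s2 1 = reg s 1 by rewrite r1.
rewrite e1; split; first by split=> //; lia.
apply: (IH (rcons xs z)) => //=.
- by rewrite cat_rcons.
- by rewrite /upd /= addn1.
- by rewrite /upd /= r2 -[reg s1 2]/(reg s 2) h2 /=; lia.
- by rewrite /upd /= r0.
- by rewrite a0.
- exact: hJ.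
Qed.

(** [Out i] holds before list [i], and [In i xs] inside it after the prefix [xs]. The time is linear
    in the encoded length because every list, even an empty one, has a length word that pays for its
    iteration. *)
Lemma wp_walk W inp e pre body post ls rest (Out : nat -> state -> Prop)
    (In : nat -> seq nat -> state -> Prop) s :
  (size inp).+1 < W -> size ls < W ->
  clean pre -> clean body -> clean post ->
  (forall i, stable_regs (Out i)) -> (forall i xs, stable_regs (In i xs)) ->
  (forall s, arr s 0 = nth 0 inp -> fits W s e /\ den s e = size ls) ->
  (forall i s, i < size ls -> reg s 0 = i -> Out i s -> sp W pre s (In i [::])) ->
  (forall i xs x ys s, i < size ls -> nth [::] ls i = xs ++ x :: ys ->
     reg s 3 = x -> reg s 0 = i -> arr s 0 = nth 0 inp -> In i xs s ->
     sp W body s (In i (rcons xs x))) ->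
  (forall i s, i < size ls -> reg s 0 = i -> In i (nth [::] ls i) s ->
     sp W post s (Out i.+1)) ->
  arr s 0 = nth 0 inp -> drop (reg s 1) inp = flatten (map encl ls) ++ rest ->
  Out 0 s ->
  wp W (walk e pre body post) s
    ((ctime pre + ctime body + ctime post + expr_time e + 50) *
       size (flatten (map encl ls)) + expr_time e + 6)
    (fun s' => [/\ Out (size ls) s', arr s' 0 = nth 0 inp & drop (reg s' 1) inp = rest]).
Proof.
move=> hW hls cpre cbody cpost hOut hIn he hpre hbody hpost ha hd h0.
pose Inv i s := [/\ Out i s, arr s 0 = nth 0 inp &
  drop (reg s 1) inp = flatten (map encl (drop i ls)) ++ rest].
have W1 : 1 < W by lia.
apply: (wp_weaken (T := \sum_(i < size ls) ((ctime pre + ctime post + 26 +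
   (ctime body + 16) * size (nth [::] ls i)) + expr_time e + 8) + expr_time e + 6)
   (Q := Inv (size ls))).
- apply: (wp_for (T := fun i => ctime pre + ctime post + 26 +
     (ctime body + 16) * size (nth [::] ls i))) => //.
  + case/andP: cpre cbody cpost => /= /and4P [p0 _ _ _] _.
    move=> /andP [/= /and4P [b0 _ _ _] _] /andP [/= /and4P [q0 _ _ _] _].
    by rewrite [wregs _]/= mem_cat negb_or p0 !in_cons !mem_cat mem_seq1 !orFb !negb_or b0 q0.
  + by move=> i s1 v [o1 a1 d1]; split=> //; apply: hOut.
  + by move=> i s1 [_ a1 _]; apply: he.
  + move=> i s1 li hi [o1 a1 d1].
    apply: (wp_leq (T := (ctime pre + (7 + (4 + ((ctime body + 16) * size (nth [::] ls i) + 4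
      + ctime post).+1).+1).+1).+1)); first by lia.
    apply: wp_seq; apply: wp_weaken (wp_frame (sp_wp (hpre i s1 li hi o1))) (leqnn _) _.
    move=> s2 [i2 f2]; have [r0 r1 r2 a2] := clean_frame cpre f2.
    have d2 : drop (reg s2 1) inp = size (nth [::] ls i) ::
       (nth [::] ls i ++ (flatten (map encl (drop i.+1 ls)) ++ rest)).
      by rewrite r1 d1 (drop_nth [::] li) /= -catA.
    have [e2 d2' lt2] := drop_consE 0 d2.
    have sz : (reg s2 1).+1 + size (nth [::] ls i) <= size inp.
      move: (congr1 size d2'); rewrite size_drop size_cat; lia.
    apply: wp_seq; apply: (@sp_wp W (Assign 2 _)) => /=; rewrite a2 a1 e2.
    split; first by split=> //; try split=> //; lia.
    apply: wp_seq; apply: (@sp_wp W (Assign 1 _)) => /=.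
    split; first by rewrite /upd /=; split=> //; lia.
    apply: wp_seq; rewrite /upd /=.
    set s3 := set_reg _ _ _.
    apply: wp_weaken (wp_frame (@wp_scan W inp body i (nth [::] ls i)
      (flatten (map encl (drop i.+1 ls)) ++ rest) (In i) (nth [::] ls i)
      [::] s3 hW cbody _ _ _ _ _ _ _ _)) (leqnn _) _ => //.
    * by move=> xs x ys s4 hl; apply: hbody hl.
    * by rewrite /s3 /= /upd /= addn1.
    * by rewrite /s3 /= /upd /=; lia.
    * by rewrite /s3 /= a2.
    * by apply: (hIn) => //; apply: (hIn).
    move=> s4 [[i4 d4] [fr4 fa4]].
    case/andP: (cbody) => /= /and4P [b0 _ _ _] b4.
    have r4 : reg s4 0 = i.
      by rewrite fr4 ?[wregs _]/= ?in_cons ?mem_cat ?mem_seq1 ?negb_or ?b0 //= /upd /= r0.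
    have a4 : arr s4 0 = nth 0 inp by rewrite fa4 /= ?cats0 // a2.
    apply: wp_weaken (wp_frame (sp_wp (hpost i s4 li r4 i4))) (leqnn _) _.
    move=> s5 [o5 f5]; have [_ q1 _ a5] := clean_frame cpost f5.
    by split; rewrite ?q1 ?a5.
  + by split=> //; rewrite drop0.
- rewrite size_flatten_encl big_distrr /= -addnA -[X in _ <= X]addnA leq_add2r.
  by apply: leq_sum => i _; lia.
- by move=> s' [o a d]; split=> //; rewrite d drop_size.
Qed.

(** * Assignments without envy *)

Section Assignments.
Variable I : instance.
Implicit Types (g h f cur : agent I -> program I) (N : {set agent I * program I}).

Definition graph g : {set agent I * program I} := [set e | g e.1 == e.2].

Definition acceptable g := forall a, g a \in agent_pref a.

(** Stability for total assignments: a blocking pair amounts to justified envy of [a] towards an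
    agent [a'] at the desired program. *)
Definition envy_free g := forall a a', g a' \in agent_pref a ->
  ranked_before (agent_pref a) (g a') (g a) -> ~~ ranked_before (prog_pref (g a')) a a'.

Definition fiber g (p : program I) : {set agent I} := [set a | g a == p].

Lemma agents_of_graph g p : agents_of (graph g) p = fiber g p.
Proof. by apply/setP=> a; rewrite !inE. Qed.

Lemma program_of_graph g a : program_of (graph g) a = Some (g a).
Proof.
rewrite /program_of; case: pickP => [p|/(_ (g a))]; rewrite inE /= ?eqxx //.
by move/eqP->.
Qed.

Lemma feasible_graph g : acceptable g -> envy_free g -> feasible (graph g).
Proof.
move=> ga ge; split.
- split; first by apply/subsetP=> -[a p]; rewrite !inE /= => /eqP <-.
  by move=> a p q; rewrite !inE /= => /eqP -> /eqP.
- move=> a p [h1 h2 [a' h3 h4]]; move: h1 h2 h3 h4.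
  rewrite program_of_graph !inE /= => /andP [_ pa] lt /eqP ep; subst p => rb.
  by move: (ge _ _ pa lt); rewrite rb.
- by move=> a; exists (g a); rewrite inE.
Qed.

(** Together with [feasible_graph], this replaces matchings by functions. Envy gives a pair outside
    the matching because [ranked_before] is irreflexive. *)
Lemma feasible_graphE N : feasible N ->
  exists h, [/\ N = graph h, acceptable h & envy_free h].
Proof.
move=> [[/subsetP sub uq] st pf].
have [h hP] := fin_all_exists pf.
have eN : N = graph h.
  apply/setP=> -[a p]; rewrite inE /=; apply/idP/eqP => [ap|<- //].
  by apply: uq (hP a) ap.
have ha : acceptable h by move=> a; have := sub _ (hP a); rewrite inE.
exists h; split=> // a a' h1 h2; apply/negP => h3.
apply: (st a (h a')); split.
- rewrite !inE /= h1 andbT eN inE /=; apply/eqP => e.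
  by move: h2; rewrite /ranked_before e ltnn.
- by rewrite eN program_of_graph.
- by exists a' => //; rewrite eN inE /= inE /=.
Qed.

Lemma total_cost_graph g : total_cost (graph g) = \sum_p #|fiber g p| * cost p.
Proof. by apply: eq_bigr => p _; rewrite agents_of_graph. Qed.

Lemma sum_cost_fiber g : \sum_p #|fiber g p| * cost p = \sum_a cost (g a).
Proof.
rewrite (partition_big g xpredT) //=; apply: eq_bigr => p _.
rewrite (eq_bigr (fun=> cost p)) => [|a /eqP -> //].
by rewrite -sum_nat_const; apply: eq_bigl => a; rewrite inE.
Qed.

Lemma card_fiber_le g p : acceptable g -> #|fiber g p| <= size (prog_pref p).
Proof.
move=> ga; apply: leq_trans (card_size _); apply/subset_leq_card/subsetP => a.
by rewrite inE -pref_sym => /eqP <-.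
Qed.

(** * Favourites among the cheapest programs *)

Section Cheapest.
Variables f g : agent I -> program I.
Hypothesis f_min : forall a q, q \in agent_pref a -> cost (f a) <= cost q.
Hypothesis g_acceptable : acceptable g.
Hypothesis g_codom : forall a, exists b, g a = f b.
Hypothesis g_best : forall a b, f b \in agent_pref a ->
  index (g a) (agent_pref a) <= index (f b) (agent_pref a).

(** Every occupied program lies in the image of [f], where [g a] is already the best acceptable
    choice for [a]; so no agent prefers an occupied program to its own. *)
Lemma cheapest_feasible : feasible (graph g).
Proof.
apply: feasible_graph => // a a' h1; have [b eb] := g_codom a'.
by rewrite /ranked_before eb in h1 *; rewrite ltnNge g_best.
Qed.

(* A program in use is the cheapest one of some agent, whose cost pays for all
   the at most [max_prog_pref I] agents assigned to it. *)
Lemma cheapest_cost N : feasible N ->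
  total_cost (graph g) <= max_prog_pref I * total_cost N.
Proof.
move=> /feasible_graphE [h [-> ha _]].
apply: (@leq_trans (max_prog_pref I * \sum_a cost (f a))); last first.
  rewrite leq_mul2l total_cost_graph sum_cost_fiber; apply/orP; right.
  by apply: leq_sum => a _; apply: f_min.
rewrite -sum_cost_fiber total_cost_graph big_distrr /=; apply: leq_sum => p _.
rewrite mulnA leq_mul2r; apply/orP; right.
have [->|/set0Pn [a]] := eqVneq (fiber g p) set0; first by rewrite cards0.
rewrite inE => /eqP ga; have [b eb] := g_codom a.
apply: (@leq_trans (max_prog_pref I * 1)); last first.
  rewrite leq_mul2l card_gt0; apply/orP; right; apply/set0Pn; exists b.
  by rewrite inE -eb ga.
rewrite muln1; apply: leq_trans (card_fiber_le _ g_acceptable) _.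
exact: (leq_bigmax p).
Qed.

End Cheapest.

(** * Load thresholds and rejections *)

Definition above cur p a : {set agent I} :=
  [set b in fiber cur p | ranked_before (prog_pref p) b a].

(** The load of the program of [a] when it keeps only [a] and the better agents there; for its worst
    agent this is the full load. *)
Definition load cur a : nat := #|above cur (cur a) a|.+1 * cost (cur a).

(* A threshold [L] is encoded as [L.+1], an infinite one as [0]. *)
Definition below (L1 v : nat) : bool := (L1 == 0) || (v.+1 < L1).

Lemma below_le L1 u v : u <= v -> below L1 v -> below L1 u.
Proof. rewrite /below; lia. Qed.

Lemma below_trans L1 V v : below L1 V -> below V.+1 v -> below L1 v.
Proof. rewrite /below; lia. Qed.

(* No feasible solution of maximum load below the threshold assigns an agent to
   a program that has already rejected it, and [g] is a solution of maximum
   load at most the threshold. *)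
Record run cur (L1 : nat) g : Prop := Run {
  run_acceptable : acceptable cur;
  run_bound : forall h, acceptable h -> envy_free h ->
    (forall p, below L1 (#|fiber h p| * cost p)) ->
    forall a, index (cur a) (agent_pref a) <= index (h a) (agent_pref a);
  run_rejected : forall a p, p \in agent_pref a ->
    index p (agent_pref a) < index (cur a) (agent_pref a) ->
    ~~ below L1 (#|above cur p a|.+1 * cost p);
  run_saved : L1 != 0 ->
    [/\ acceptable g, envy_free g & forall p, #|fiber g p| * cost p < L1]
}.

Lemma run_start cur g : acceptable cur ->
  (forall a, index (cur a) (agent_pref a) = 0) -> run cur 0 g.
Proof. by move=> ca c0; split=> // [h _ _ _ a|a p _]; rewrite c0. Qed.

Lemma mem_above cur p a b : (b \in above cur p a) =
  (cur b == p) && ranked_before (prog_pref p) b a.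
Proof. by rewrite !inE. Qed.

Lemma above_subset cur p a a' : index a (prog_pref p) <= index a' (prog_pref p) ->
  above cur p a \subset above cur p a'.
Proof.
move=> le; apply/subsetP=> b; rewrite !mem_above => /andP [-> /=].
by rewrite /ranked_before => lt; apply: leq_trans le.
Qed.

Lemma fiber_load cur V p : acceptable cur -> (forall a, load cur a <= V) ->
  #|fiber cur p| * cost p <= V.
Proof.
move=> ca lV; have [->|/set0Pn [a0 a0p]] := eqVneq (fiber cur p) set0.
  by rewrite cards0.
case: (arg_maxnP (fun a => index a (prog_pref p)) a0p) => a ap amax.
have {}ap : a \in fiber cur p := ap.
have ea : cur a = p by move: ap; rewrite inE => /eqP.
apply: leq_trans (lV a); rewrite /load ea leq_mul2r; apply/orP; right.
rewrite (cardsD1 a) ap add1n ltnS; apply/subset_leq_card/subsetP => b.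
rewrite in_setD1 mem_above => /andP [ne bp]; move: (bp); rewrite inE => -> /=.
have le : index b (prog_pref p) <= index a (prog_pref p) by apply: amax.
rewrite /ranked_before ltn_neqAle le andbT; apply: contraNneq ne => e.
(* Acceptability puts these agents on the list of [p], where equal positions mean equal agents. *)
have bin x : x \in fiber cur p -> x \in prog_pref p.
  by rewrite inE -pref_sym => /eqP <-.
by rewrite -(nth_index a (bin _ bp)) -{2}(nth_index a (bin _ ap)) e.
Qed.

(** For envy-freeness: if [a] had left the program of [a'] while ranked above [a'] there, the load
    that justifies this rejection would be at most that of [a'], hence at most [V] and below the old
    threshold. *)
Lemma run_save cur L1 g V : run cur L1 g -> (forall a, load cur a <= V) ->
  below L1 V -> run cur V.+1 cur.
Proof.
case=> ca hb hr _ lV bV; split=> //.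
- by move=> h ah eh bh; apply: hb => // p; apply: below_trans bV _.
- move=> a p pa lt; apply: contra (hr a p pa lt); exact: below_trans bV.
move=> _; split=> //; last by move=> p; rewrite ltnS; apply: fiber_load.
move=> a a' h1 h2; apply/negP=> h3; have := hr _ _ h1 h2; apply/negP; rewrite negbK.
apply: below_le bV; apply: leq_trans (lV a').
rewrite /load leq_mul2r ltnS subset_leq_card ?orbT //.
exact/above_subset/ltnW.
Qed.

(** Suppose [h a = cur a = p]. An agent currently at [p] and ranked above [a] cannot do better than
    [p] in [h], nor worse, since it would then envy [a]. So [h] puts all these agents and [a] at
    [p], whose load is then not below the threshold. *)
Lemma run_strict cur L1 g a h : run cur L1 g -> ~~ below L1 (load cur a) ->
  acceptable h -> envy_free h -> (forall p, below L1 (#|fiber h p| * cost p)) ->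
  index (cur a) (agent_pref a) < index (h a) (agent_pref a).
Proof.
case=> ca hb _ _ nb ha he hbel; rewrite ltn_neqAle hb // andbT.
apply/eqP=> e; have eh : h a = cur a.
  by rewrite -(nth_index (h a) (ha a)) -e nth_index.
case/negP: nb; set p := cur a in eh *.
apply: below_le (hbel p); rewrite /load -/p leq_mul2r; apply/orP; right.
suff sub : a |: above cur p a \subset fiber h p.
  apply: leq_trans (subset_leq_card sub); rewrite cardsU1 mem_above.
  by rewrite /ranked_before ltnn andbF.
apply/subsetP=> b; rewrite in_setU1 => /orP [/eqP -> | ]; first by rewrite inE eh.
rewrite mem_above inE => /andP [/eqP cb rb].
have pb : p \in agent_pref b by rewrite -cb.
have := hb _ ha he hbel b; rewrite cb leq_eqVlt => /orP [/eqP ei|lt].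
  by rewrite -(nth_index p (ha b)) -ei nth_index.
by have := he b a; rewrite eh => /(_ pb lt); rewrite rb.
Qed.

(** The departure of [a] can only weaken the rejection, at its old program, of agents ranked below
    [a]. These stay justified by the agents above [a], which with one more agent already reach the
    threshold. *)
Lemma run_advance cur cur' L1 g a : run cur L1 g -> ~~ below L1 (load cur a) ->
  (forall b, b != a -> cur' b = cur b) -> cur' a \in agent_pref a ->
  index (cur' a) (agent_pref a) = (index (cur a) (agent_pref a)).+1 ->
  run cur' L1 g.
Proof.
move=> hrun nb same ina next; case: (hrun) => ca hb hr hs; split=> //.
- by move=> b; have [->|/same ->] := eqVneq b a.
- move=> h ah eh bh b; have [->|/same ->] := eqVneq b a; last exact: hb.
  by rewrite next; apply: run_strict hrun nb ah eh bh.
(* A set [above] can lose only [a], and the arrival of [a] elsewhere can only enlarge it. *)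
have key b p : ~~ below L1 (#|above cur p b|.+1 * cost p) ->
    (cur a = p -> ~~ ranked_before (prog_pref p) a b) ->
    ~~ below L1 (#|above cur' p b|.+1 * cost p).
  move=> nb' hab; apply: contra nb'; apply: below_le.
  rewrite leq_mul2r ltnS subset_leq_card ?orbT //; apply/subsetP=> x.
  rewrite !mem_above; have [->|/same -> //] := eqVneq x a.
  by move=> /andP [/eqP e r]; move: (hab e); rewrite r.
(* No agent is above itself, so this set does not lose [a]. *)
have keya : ~~ below L1 (#|above cur' (cur a) a|.+1 * cost (cur a)).
  by apply: key => // _; rewrite /ranked_before ltnn.
move=> b p pb lt.
have [ea|na] := boolP ((cur a == p) && ranked_before (prog_pref p) a b).
  case/andP: ea => /eqP ea rab; rewrite ea in keya.
  apply: contra keya; apply: below_le.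
  by rewrite leq_mul2r ltnS subset_leq_card ?orbT //; apply/above_subset/ltnW.
have {}na : cur a = p -> ~~ ranked_before (prog_pref p) a b.
  by move=> e; move: na; rewrite e eqxx.
have [eb|nba] := eqVneq b a; last first.
  by apply: key => //; apply: hr => //; rewrite -same.
subst b; move: lt; rewrite next ltnS leq_eqVlt => /orP [/eqP e|lt].
  have ep : p = cur a by rewrite -(nth_index p pb) e nth_index.
  by rewrite ep.
by apply: key => //; apply: hr.
Qed.

(** By [run_strict], a feasible [h] with all loads below the threshold would place [a] beyond the
    end of its list. So some program of [h] has at least the load of every program of the saved [g];
    summing over all programs gives the factor. *)
Lemma run_final cur L1 g a N : run cur L1 g -> ~~ below L1 (load cur a) ->
  (index (cur a) (agent_pref a)).+1 = size (agent_pref a) -> feasible N ->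
  feasible (graph g) /\ total_cost (graph g) <= #|program I| * total_cost N.
Proof.
move=> hrun nb last fN; have [h [-> ha he]] := feasible_graphE fN.
have [p np] : exists p, ~~ below L1 (#|fiber h p| * cost p).
  apply/existsP; rewrite -negb_forall; apply/negP => /forallP bh.
  have := run_strict hrun nb ha he bh.
  by rewrite -ltnS last ltnS leqNgt index_mem ha.
(* Every load is below the infinite threshold, encoded by 0; hence the threshold is finite and [g]
   has been saved. *)
have L0 : L1 != 0 by apply: contra np => /eqP ->.
have [ga ge gl] := run_saved hrun L0.
split; first exact: feasible_graph.
rewrite !total_cost_graph -sum_nat_const; apply: leq_sum => q _.
apply: (@leq_trans (#|fiber h p| * cost p)).
  by have := gl q; move: np; rewrite /below; lia.
by rewrite (bigD1 p) //= leq_addr.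
Qed.

End Assignments.

(** * The encoding of an instance *)

Section Encoding.
Variable I : instance.

Definition agent_lists : seq (seq nat) := [seq map val (agent_pref a) | a : 'I_(nA I)].
Definition prog_lists : seq (seq nat) := [seq map val (prog_pref p) | p : 'I_(nB I)].

Lemma encodeE : encode I = [:: nA I; nB I] ++ [seq cost p | p : 'I_(nB I)]
  ++ flatten (map encl agent_lists) ++ flatten (map encl prog_lists).
Proof.
rewrite /encode /agent_lists /prog_lists /image_mem -!map_comp.
congr (_ ++ (_ ++ (flatten _ ++ flatten _))); apply: eq_map => x /=;
  by rewrite /encode_list /encl size_map.
Qed.

Lemma size_agent_lists : size agent_lists = nA I.
Proof. by rewrite size_image card_ord. Qed.

Lemma size_prog_lists : size prog_lists = nB I.
Proof. by rewrite size_image card_ord. Qed.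

Lemma nth_agent_lists (a : 'I_(nA I)) : nth [::] agent_lists a = map val (agent_pref a).
Proof. by rewrite (nth_map a) ?nth_ord_enum // size_enum_ord. Qed.

Lemma nth_prog_lists (p : 'I_(nB I)) : nth [::] prog_lists p = map val (prog_pref p).
Proof. by rewrite (nth_map p) ?nth_ord_enum // size_enum_ord. Qed.

Lemma encode1 : nth 0 (encode I) 1 = nB I. Proof. by []. Qed.

Lemma encode_cost (p : 'I_(nB I)) : nth 0 (encode I) p.+2 = cost p.
Proof.
rewrite encodeE /= nth_cat size_image card_ord ltn_ord.
by rewrite (nth_map p) ?nth_ord_enum // size_enum_ord.
Qed.

Lemma drop_encode : drop (nB I).+2 (encode I) =
  flatten (map encl agent_lists) ++ flatten (map encl prog_lists).
Proof. by rewrite encodeE /= drop_cat size_image card_ord ltnn subnn drop0. Qed.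

Lemma input_sizeE : input_size I = (nB I).+2 +
  (size (flatten (map encl agent_lists)) + size (flatten (map encl prog_lists))).
Proof. by rewrite /input_size encodeE /= !size_cat size_image card_ord. Qed.

Lemma encode_le k : nth 0 (encode I) k <= \max_(x <- encode I) x.
Proof.
have [lt|le] := ltnP k (size (encode I)); last by rewrite nth_default.
by apply: (@leq_bigmax_seq _ (encode I) xpredT id) => //; apply: mem_nth.
Qed.

(** Quadratic room suffices: the only products formed are of a number of agents and a cost. *)
Lemma word_bound_ge K : 1 < K ->
  K * (input_size I + \max_(x <- encode I) x) ^ 2 <= word_bound K I.
Proof.
move=> K1; rewrite /word_bound leq_mul2l; apply/orP; right.
by apply: leq_pexp2l => //; rewrite input_sizeE.
Qed.

Lemma outputE s (g : agent I -> program I) :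
  (forall a : agent I, arr s 1 (val a) = val (g a)) -> output I s = graph g.
Proof. by move=> h; apply/setP=> -[a p]; rewrite !inE /= h val_eqE. Qed.

End Encoding.

(** The offset 2 skips the two cardinalities. *)
Definition cost_cell (I : instance) (q : nat) : nat := nth 0 (encode I) q.+2.

(* Options of naturals are encoded by [0] for [None] and [y.+1] for [Some y]. *)
Definition cheapest1 (c : nat -> nat) (xs : seq nat) : nat :=
  foldl (fun b y => if (b == 0) || (c y < c b.-1) then y.+1 else b) 0 xs.

Definition first1 (mk : pred nat) (xs : seq nat) : nat :=
  foldl (fun b y => if (b == 0) && mk y then y.+1 else b) 0 xs.

Lemma cheapest1P c xs : xs != [::] ->
  exists y, [/\ y \in xs, cheapest1 c xs = y.+1 & forall z, z \in xs -> c y <= c z].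
Proof.
elim/last_ind: xs => // xs x IH _; rewrite /cheapest1 foldl_rcons -/(cheapest1 c xs).
have [->|/IH [y [yin -> ymin]]] := eqVneq xs [::].
  by exists x; split=> // [|z]; rewrite mem_seq1 // => /eqP ->.
rewrite /=; case: ltnP => le; [exists x|exists y]; split=> //;
  rewrite ?mem_rcons ?inE ?eqxx ?yin ?orbT // => z;
  rewrite mem_rcons inE => /orP [/eqP -> //|/ymin]; lia.
Qed.

Lemma first1P mk xs : has mk xs ->
  exists y, [/\ y \in xs, first1 mk xs = y.+1, mk y &
    forall z, z \in xs -> mk z -> index y xs <= index z xs].
Proof.
(* The first hit freezes the accumulator. *)
have stop y : forall zs, foldl (fun b y => if (b == 0) && mk y then y.+1 else b) y.+1 zs = y.+1.
  by elim.
elim: xs => //= x xs IH; rewrite /first1 /=.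
have [mx _|nx /= /IH [y [yin fy my ymin]]] := boolP (mk x).
  by exists x; split; rewrite ?inE ?eqxx.
exists y; split=> //; first by rewrite inE yin orbT.
move=> z; rewrite inE => /orP [/eqP ->|zin mz]; first by rewrite (negPf nx).
have [ex|_] := eqVneq x y; first by rewrite ex.
have [ex|_] := eqVneq x z; first by rewrite ex mz in nx.
exact: ymin.
Qed.

Lemma first1_le mk xs n : (forall x, x \in xs -> x < n) -> first1 mk xs <= n.
Proof.
elim/last_ind: xs => // xs x IH h; rewrite /first1 foldl_rcons -/(first1 mk xs).
case: ifP => _; first by apply: h; rewrite mem_rcons inE eqxx.
by apply: IH => y yin; apply: h; rewrite mem_rcons inE yin orbT.
Qed.

Lemma cheapest1_le c xs n : (forall x, x \in xs -> x < n) -> cheapest1 c xs <= n.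
Proof.
elim/last_ind: xs => // xs x IH h; rewrite /cheapest1 foldl_rcons -/(cheapest1 c xs).
case: ifP => _; first by apply: h; rewrite mem_rcons inE eqxx.
by apply: IH => y yin; apply: h; rewrite mem_rcons inE yin orbT.
Qed.

(** * The linear-time algorithm *)

Definition n_agents : expr := Get 0 (Cst 0).
Definition n_programs : expr := Get 0 (Cst 1).

Definition to_agent_lists : cmd := Assign 1 (Bin Add (Cst 2) n_programs).

(* Array 2 marks, shifted by one, the programs that are cheapest for some
   agent. *)
Definition mark_cheapest : cmd :=
  walk n_agents (Assign 4 (Cst 0))
    (If (Bin Add (Bin Eq (Reg 4) (Cst 0))
           (Bin Lt (Get 0 (Bin Add (Reg 3) (Cst 2))) (Get 0 (Bin Add (Reg 4) (Cst 1)))))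
       (Assign 4 (Bin Add (Reg 3) (Cst 1))) Skip)
    (Store 2 (Reg 4) (Cst 1)).

(** The comparison acts as a conjunction: marks are 0 or 1, so it succeeds only if nothing has been
    chosen yet and the program is marked. *)
Definition choose_marked : cmd :=
  walk n_agents (Assign 4 (Cst 0))
    (If (Bin Lt (Reg 4) (Get 2 (Bin Add (Reg 3) (Cst 1))))
       (Assign 4 (Bin Add (Reg 3) (Cst 1))) Skip)
    (Store 1 (Reg 0) (Bin Defs.Sub (Reg 4) (Cst 1))).

Definition linear_cmd : cmd :=
  Seq to_agent_lists (Seq mark_cheapest (Seq to_agent_lists choose_marked)).

Section LinearAlgorithm.
Variables (I : instance) (W : nat).
Hypothesis W_large : input_size I + 10 < W.

Let inp := encode I.
Let ls := agent_lists I.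
Let rest := flatten (map encl (prog_lists I)).
Let c := cost_cell I.

Let W_size : (size inp).+1 < W.
Proof. by rewrite -/(input_size I); lia. Qed.

Let W_programs : nB I + 10 < W.
Proof. by move: W_large; rewrite input_sizeE; lia. Qed.

Let size_ls_le : size ls <= input_size I.
Proof.
rewrite input_sizeE -/ls size_flatten_encl.
suff : size ls <= \sum_(i < size ls) (size (nth [::] ls i)).+1 by lia.
rewrite -[X in X <= _](card_ord (size ls)) -sum1_card; exact: leq_sum.
Qed.

Let W_lists : size ls < W.
Proof. by move: size_ls_le; lia. Qed.

Let entry_lt i x : i < size ls -> x \in nth [::] ls i -> x < nB I.
Proof.
rewrite size_agent_lists => li; rewrite (nth_agent_lists (Ordinal li)).
by case/mapP=> p _ ->; apply: ltn_ord.
Qed.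

Let bound_ok s : arr s 0 = nth 0 inp -> fits W s n_agents /\ den s n_agents = size ls.
Proof. by move=> /= ->; rewrite size_agent_lists; split=> //; move: W_programs; lia. Qed.

Lemma to_agent_listsP s Q : arr s 0 = nth 0 inp ->
  (Q (set_reg s 1 (nB I).+2)) -> wp W to_agent_lists s 5 Q.
Proof.
move=> ha q; apply: (@sp_wp W to_agent_lists) => /=; rewrite ha encode1.
split=> //; move: W_programs; split=> //; lia.
Qed.

(** An empty list marks cell 0, which the shift by one keeps apart from the programs. *)
Lemma mark_cheapestP s : arr s 0 = nth 0 inp -> reg s 1 = (nB I).+2 ->
  (forall k, arr s 2 k = 0) ->
  wp W mark_cheapest s (100 * input_size I) (fun s' => arr s' 0 = nth 0 inp /\
    forall k, arr s' 2 k = (k \in map (cheapest1 c) ls)).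
Proof.
move=> ha h1 h2.
pose Out i s := forall k, arr s 2 k = (k \in map (cheapest1 c) (take i ls)).
pose In i xs s := Out i s /\ reg s 4 = cheapest1 c xs.
have WP := W_programs.
apply: (wp_weaken (wp_walk (inp := inp) (ls := ls) (rest := rest) (Out := Out) (In := In)
  _ _ _ _ _ _ _ _ _ _ _ _ _ _)) => //.
- by move=> i s1 r v.
- by move=> i xs s1 r v; rewrite !inE => /or4P [] /eqP -> [].
- by move=> i s1 li _ o; split; first by rewrite /=; lia.
- move=> i xs x ys s1 li hl h3 h0 a1 [o e4] /=.
  have xin : x < nB I by apply: (entry_lt li); rewrite hl mem_cat mem_head orbT.
  have xle : cheapest1 c xs <= nB I.
    by apply: cheapest1_le => y yin; apply: (entry_lt li); rewrite hl mem_cat yin.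
  (* The sum of two truth values is a disjunction. Without a candidate, the cost comparison reads
     cell 1, but the first summand already makes the test succeed. *)
  rewrite h3 e4 a1 /=; split.
  + by do !split=> //; lia.
  + move=> hne; split; first by split=> //; lia.
    split=> //=; rewrite /cheapest1 foldl_rcons -/(cheapest1 c xs) /upd /= addn1.
    case: ifP => // /negbT; rewrite negb_or => /andP [n1 n2].
    move: hne n2; rewrite /c /cost_cell (negPf n1) addn2 addn1 prednK ?lt0n //.
    by move=> /[swap] /negPf ->.
  + move=> he; split=> //; rewrite /cheapest1 foldl_rcons -/(cheapest1 c xs).
    case: ifP => // /orP [/eqP e0|lt]; first by move: he; rewrite e0.
    have [e0|n0] := eqVneq (cheapest1 c xs) 0; first by move: he; rewrite e0.
    by move: he lt; rewrite /c /cost_cell addn2 addn1 prednK ?lt0n // => /[swap] ->; rewrite addn1.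
- move=> i s1 li h0 [o e4] /=; split=> //; first by lia.
  move=> k /=; rewrite e4 (take_nth [::] li) map_rcons mem_rcons inE /upd /=.
  by case: (k == _) => //=; rewrite o.
- by rewrite h1 drop_encode.
- by move=> k; rewrite h2 take0.
- by rewrite /= input_sizeE -/ls; lia.
- by move=> s' [o a0 d]; split=> // k; rewrite o take_size.
Qed.

Lemma choose_markedP mk s : arr s 0 = nth 0 inp -> reg s 1 = (nB I).+2 ->
  (forall k, arr s 2 k.+1 = (mk k : bool)) ->
  wp W choose_marked s (100 * input_size I) (fun s' =>
    forall i, i < size ls -> arr s' 1 i = (first1 mk (nth [::] ls i)).-1).
Proof.
move=> ha h1 h2.
pose Out i s := (forall k, arr s 2 k.+1 = (mk k : bool)) /\
  forall j, j < i -> arr s 1 j = (first1 mk (nth [::] ls j)).-1.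
pose In i xs s := Out i s /\ reg s 4 = first1 mk xs.
have WP := W_programs.
apply: (wp_weaken (wp_walk (inp := inp) (ls := ls) (rest := rest) (Out := Out) (In := In)
  _ _ _ _ _ _ _ _ _ _ _ _ _ _)) => //.
- by move=> i s1 r v.
- by move=> i xs s1 r v; rewrite !inE => /or4P [] /eqP -> [].
- by move=> i s1 li _ o; split; first by rewrite /=; lia.
- move=> i xs x ys s1 li hl h3 h0 a1 [o e4] /=.
  have xin : x < nB I by apply: (entry_lt li); rewrite hl mem_cat mem_head orbT.
  case: (o) => o1 _; rewrite h3 e4 addn1 o1 /=; split.
  + by do !split=> //; lia.
  + move=> hne; split; first by split=> //; lia.
    split=> //=; rewrite /first1 foldl_rcons -/(first1 mk xs) /upd /=.
    by move: hne; case: (first1 mk xs) => [|?]; case: (mk x).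
  + move=> he; split=> //; rewrite e4 /first1 foldl_rcons -/(first1 mk xs).
    by move: he; case: (first1 mk xs) => [|?]; case: (mk x).
- move=> i s1 li h0 [[o1 o2] e4] /=.
  have le : first1 mk (nth [::] ls i) <= nB I.
    by apply: first1_le => y yin; apply: (entry_lt li).
  split=> //; first by split=> //; rewrite ?e4; lia.
  split=> //= j; rewrite h0 e4 subn1 /upd /= ltnS leq_eqVlt.
  by case: eqP => [-> //|_] /= /o2.
- by rewrite h1 drop_encode.
- by rewrite /= input_sizeE -/ls; lia.
- by move=> s' [[_ o] _ _].
Qed.

Lemma linear_cmdP : wp W linear_cmd (initial_state I) (300 * input_size I)
  (fun s' => forall i, i < size ls -> arr s' 1 i =
    (first1 (fun k => k.+1 \in map (cheapest1 c) ls) (nth [::] ls i)).-1).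
Proof.
apply: (@wp_leq _ _ _ ((5 + (100 * input_size I + (5 + 100 * input_size I).+1).+1).+1)).
  by rewrite input_sizeE; lia.
apply: wp_seq; apply: to_agent_listsP => //.
apply: wp_seq; apply: wp_weaken (mark_cheapestP _ _ _) (leqnn _) _ => // s1 [a1 m1].
apply: wp_seq; apply: to_agent_listsP => //.
by apply: choose_markedP => // k; apply: m1.
Qed.

End LinearAlgorithm.

Lemma linear_time_part : has_linear_time_approximation max_prog_pref.
Proof.
exists linear_cmd, 300 => I.
have large : input_size I + 10 < word_bound 300 I.
  apply: leq_trans (word_bound_ge I (isT : 1 < 300)).
  by rewrite input_sizeE -mulnn; lia.
have [t [s [ex le out]]] := linear_cmdP large.
exists t, s; split=> // Mopt [fM _].
(* A feasible solution exists, so no agent has an empty list. *)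
have [h [_ ha _]] := feasible_graphE fM.
set ls := agent_lists I in out; set c := cost_cell I in out.
pose mk k := k.+1 \in map (cheapest1 c) ls.
have mkP (a : agent I) : nth [::] ls a \in ls.
  by rewrite mem_nth // size_agent_lists ltn_ord.
have [f fP] : exists f : agent I -> program I, forall a, [/\ f a \in agent_pref a,
    cheapest1 c (nth [::] ls a) = (val (f a)).+1 &
    forall q, q \in agent_pref a -> cost (f a) <= cost q].
  apply: (@fin_all_exists _ (fun=> program I) (fun a p => [/\ p \in agent_pref a,
    cheapest1 c (nth [::] ls a) = (val p).+1 &
    forall q, q \in agent_pref a -> cost p <= cost q])) => a.
  have ne : map val (agent_pref a) != [::] by move: (ha a); case: (agent_pref a).
  rewrite nth_agent_lists; have [y [yin ey ymin]] := cheapest1P c ne.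
  move: yin ymin ey => /mapP [p pin ->] ymin ep.
  exists p; split=> // q qin; rewrite -!encode_cost; apply: ymin.
  exact: map_f.
have mk_f b : mk (val (f b)).
  by have [_ e _] := fP b; rewrite /mk -e map_f.
have [g gP] : exists g : agent I -> program I, forall a, [/\ g a \in agent_pref a,
    arr s 1 (val a) = val (g a), mk (val (g a)) & forall q, q \in agent_pref a -> mk (val q) ->
      index (g a) (agent_pref a) <= index q (agent_pref a)].
  apply: (@fin_all_exists _ (fun=> program I) (fun a p => [/\ p \in agent_pref a,
    arr s 1 (val a) = val p, mk (val p) & forall q, q \in agent_pref a -> mk (val q) ->
      index p (agent_pref a) <= index q (agent_pref a)])) => a.
  have hm : has mk (map val (agent_pref a)).
    apply/hasP; exists (val (f a)) => //.
    by have [fin _ _] := fP a; apply: map_f.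
  rewrite out ?size_agent_lists ?ltn_ord // nth_agent_lists.
  have [y [yin -> my ymin]] := first1P hm.
  move: yin my ymin => /mapP [p pin ->] mp pmin; exists p; split=> // q qin mq.
  have := pmin _ (map_f val qin) mq; rewrite !index_map //; exact: val_inj.
rewrite (@outputE _ s g); last by move=> a; case: (gP a).
have g_acc : acceptable g by move=> a; case: (gP a).
have f_min a q : q \in agent_pref a -> cost (f a) <= cost q.
  by case: (fP a) => _ _; apply.
(* A mark is the value of [cheapest1] on the list of some agent [b], so it stands for [f b]. *)
have g_codom a : exists b, g a = f b.
  case: (gP a) => _ _ /mapP [l /mapP [b _ ->] e] _; exists b; apply/val_inj/eq_add_S.
  by rewrite e; case: (fP b) => _; rewrite nth_agent_lists.
split; last exact: (cheapest_cost f_min g_acc g_codom).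
apply: (cheapest_feasible g_acc g_codom) => a b fb.
by case: (gP a) => _ _ _; apply.
Qed.

(** * Minimising the maximum load *)

(* Registers: 4 is nonzero once an agent has run out of programs (or there is
   no agent), 5 is the encoded threshold, 6 the number of agents seen at the
   current program, 7 the maximum load so far and 8 the agent attaining it, 9
   the address of the lists of the programs.  Arrays 2 and 3 hold the read and
   end addresses of the lists of the agents. *)
Definition start_agents : cmd :=
  for_loop 0 n_agents
    (Seq (Store 2 (Reg 0) (Bin Add (Reg 1) (Cst 1)))
    (Seq (Assign 4 (Bin Add (Reg 4) (Bin Eq (Get 0 (Reg 1)) (Cst 0))))
    (Seq (Assign 1 (Bin Add (Bin Add (Reg 1) (Cst 1)) (Get 0 (Reg 1))))
         (Store 3 (Reg 0) (Reg 1))))).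

Definition init_cmd : cmd :=
  Seq to_agent_lists
    (Seq (Assign 4 (Bin Eq n_agents (Cst 0))) (Seq start_agents (Assign 9 (Reg 1)))).

Definition current_load : expr := Bin Mul (Reg 6) (Get 0 (Bin Add (Reg 0) (Cst 2))).

(** Each program's list is read from best to worst, so the counter times the cost is the load of the
    agent just read. Ties with the maximum update register 8; thus some agent is recorded even if
    all loads are 0. *)
Definition loads_walk : cmd :=
  walk n_programs (Assign 6 (Cst 0))
    (If (Bin Eq (Get 0 (Get 2 (Reg 3))) (Reg 0))
       (Seq (Assign 6 (Bin Add (Reg 6) (Cst 1)))
          (If (Bin Lt (Reg 7) (Bin Add current_load (Cst 1)))
             (Seq (Assign 7 current_load) (Assign 8 (Reg 3))) Skip))
       Skip)
    Skip.

Definition max_load_cmd : cmd :=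
  Seq (Seq (Assign 7 (Cst 0)) (Seq (Assign 8 (Cst 0)) (Assign 1 (Reg 9)))) loads_walk.

Definition save_loop : cmd := for_loop 0 n_agents (Store 1 (Reg 0) (Get 0 (Get 2 (Reg 0)))).

Definition save_cmd : cmd :=
  If (Bin Add (Bin Eq (Reg 5) (Cst 0)) (Bin Lt (Bin Add (Reg 7) (Cst 1)) (Reg 5)))
     (Seq (Assign 5 (Bin Add (Reg 7) (Cst 1))) save_loop) Skip.

Definition advance_cmd : cmd :=
  Seq (Store 2 (Reg 8) (Bin Add (Get 2 (Reg 8)) (Cst 1)))
      (Assign 4 (Bin Eq (Get 2 (Reg 8)) (Get 3 (Reg 8)))).

Definition round_cmd : cmd := Seq max_load_cmd (Seq save_cmd advance_cmd).

Definition poly_cmd : cmd := Seq init_cmd (While (Bin Eq (Reg 4) (Cst 0)) round_cmd).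

Section PolynomialAlgorithm.
Variables (I : instance) (W : nat).
Let B := input_size I + \max_(x <- encode I) x.
Hypothesis W_large : B ^ 2 + 20 < W.

Let inp := encode I.
Let ls := agent_lists I.
Let rest := flatten (map encl (prog_lists I)).

Let size_inp : size inp = input_size I. Proof. by []. Qed.

Let W_word n : n <= B -> n + 20 < W.
Proof. by move: W_large; rewrite -mulnn; move: B => b *; nia. Qed.

Let W_large1 : input_size I + 10 < W.
Proof. by have := W_word (leq_addr _ _ : input_size I <= B); lia. Qed.

Let W_prod m n : m <= input_size I -> m * nth 0 inp n + 20 < W.
Proof.
move=> hm; have hn := encode_le I n; rewrite -/inp in hn.
move: W_large hn; rewrite /B -mulnn; set x := nth 0 inp n; set y := \max_(_ <- _) _.
by move: (input_size I) x y hm => N x y *; nia.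
Qed.

Let size_ls_le : size ls + nB I + 2 <= input_size I.
Proof.
rewrite input_sizeE -/ls size_flatten_encl.
suff : size ls <= \sum_(i < size ls) (size (nth [::] ls i)).+1 by lia.
rewrite -[X in X <= _](card_ord (size ls)) -sum1_card; exact: leq_sum.
Qed.

Let word_bool (b : bool) : b < W.
Proof. by apply: leq_ltn_trans (leq_b1 _) _; move: W_large1; lia. Qed.

Let agents_ok s : arr s 0 = nth 0 inp -> fits W s n_agents /\ den s n_agents = nA I.
Proof. by move=> /= ->; split=> //; move: W_large1; lia. Qed.

(** Register 4 is 0 exactly when there are agents and none has an empty list. *)
Definition start_spec (s : state) : Prop :=
  [/\ arr s 0 = nth 0 inp, drop (reg s 9) inp = rest,
      reg s 4 = (nA I == 0) + count (fun l => size l == 0) ls, reg s 5 = 0 &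
      forall a : agent I, arr s 3 a = arr s 2 a + size (agent_pref a) /\
        exists t, drop (arr s 2 a) inp = map val (agent_pref a) ++ t].

Lemma init_cmdP : wp W init_cmd (initial_state I) (100 * input_size I) start_spec.
Proof.
have sz := size_ls_le; have WN := W_large1; rewrite size_agent_lists in sz.
apply: (@wp_leq _ _ _ (5 + (5 + ((\sum_(i < nA I) (30 + 2 + 8) + 2 + 6) + 2).+1).+1).+1).
  by rewrite sum_nat_const card_ord; lia.
apply: wp_seq; apply: (@to_agent_listsP I) => //.
apply: wp_seq; apply: (@sp_wp W (Assign 4 _)) => /=.
split; first by do !split=> //; lia.
set s0 := set_reg _ _ _.
pose Inv i s := [/\ arr s 0 = nth 0 inp,
   drop (reg s 1) inp = flatten (map encl (drop i ls)) ++ rest,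
   reg s 4 = (nA I == 0) + count (fun l => size l == 0) (take i ls), reg s 5 = 0 &
   forall a : agent I, a < i -> arr s 3 a = arr s 2 a + size (agent_pref a) /\
     exists t, drop (arr s 2 a) inp = map val (agent_pref a) ++ t].
apply: wp_seq; apply: (wp_weaken (wp_for (n := nA I) (e := n_agents) (Inv := Inv)
  (T := fun=> 30) _ _ _ _ _ _ _)) => //.
- by lia.
- by lia.
- by move=> i s [a0 _ _ _ _]; apply: agents_ok.
- move=> i s li hi [a0 d1 r4 r5 ha].
  have lis : i < size ls by rewrite size_agent_lists.
  have d2 : drop (reg s 1) inp = size (nth [::] ls i) ::
       (nth [::] ls i ++ (flatten (map encl (drop i.+1 ls)) ++ rest)).
    by rewrite d1 (drop_nth [::] lis) /= -catA.
  have [e2 d2' lt2] := drop_consE 0 d2.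
  have sz2 : (reg s 1).+1 + size (nth [::] ls i) <= size inp.
    by move: (congr1 size d2'); rewrite size_drop size_cat; lia.
  have cle : count (fun l => size l == 0) (take i ls) <= nA I.
    apply: leq_trans (count_size _ _) _; rewrite size_take lis; lia.
  rewrite size_inp in sz2 lt2.
  apply: (@wp_leq _ _ _ (ctime (Seq (Store 2 (Reg 0) (Bin Add (Reg 1) (Cst 1)))
    (Seq (Assign 4 (Bin Add (Reg 4) (Bin Eq (Get 0 (Reg 1)) (Cst 0))))
    (Seq (Assign 1 (Bin Add (Bin Add (Reg 1) (Cst 1)) (Get 0 (Reg 1))))
         (Store 3 (Reg 0) (Reg 1))))))) => //.
  apply: sp_wp; rewrite /= /upd /= hi a0 e2 r4.
  split=> //; first by split=> //; lia.
  split; first by do !split=> //; try lia; case: (_ == 0); case: (_ == 0); lia.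
  split; first by do !split=> //; lia.
  split=> //; split=> //=; rewrite /upd /=.
  + by rewrite addn1 addnC -drop_drop d2' drop_size_cat.
  + by rewrite (take_nth [::] lis) -cats1 count_cat /= addn0 addnA.
  + move=> a; rewrite ltnS leq_eqVlt => /orP [/eqP e|lt].
      rewrite e !eqxx -e nth_agent_lists size_map addn1; split=> //.
      by rewrite d2' -e nth_agent_lists; eexists.
    by rewrite (ltn_eqF lt); apply: ha.
- by split; [ | rewrite drop0; exact: drop_encode | rewrite take0 addn0 | | ].
- move=> s [a0 d1 r4 r5 ha]; apply: (@sp_wp W (Assign 9 (Reg 1))) => /=; split=> //.
  have ls_nA : size ls <= nA I by rewrite size_agent_lists.
  rewrite (drop_oversize ls_nA) in d1; rewrite (take_oversize ls_nA) in r4.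
  by split; [ | exact: d1 | exact: r4 | | move=> a; apply: ha].
Qed.

Variable base : agent I -> nat.
Hypothesis base_size : forall a, base a + size (agent_pref a) <= size inp.
Hypothesis base_nth : forall a k, k < size (agent_pref a) ->
  nth 0 inp (base a + k) = nth 0 (map val (agent_pref a)) k.

Implicit Types cur g : agent I -> program I.

(** Neither the current programs nor their positions are stored: array 2 holds addresses of current
    entries, and [base a] is where the list of [a] starts. *)
Record rep cur (L1 : nat) g (s : state) : Prop := Rep {
  rep_input : arr s 0 = nth 0 inp;
  rep_lists : drop (reg s 9) inp = rest;
  rep_threshold : reg s 5 = L1;
  rep_pos : forall a : agent I, arr s 2 a = base a + index (cur a) (agent_pref a);
  rep_end : forall a : agent I, arr s 3 a = base a + size (agent_pref a);
  rep_saved : L1 != 0 -> forall a : agent I, arr s 1 a = g a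
}.

Lemma rep_current cur L1 g s a : acceptable cur -> rep cur L1 g s ->
  nth 0 inp (arr s 2 (val a)) = val (cur a).
Proof.
move=> ca hs; rewrite (rep_pos hs) base_nth ?index_mem //.
by rewrite (nth_map (cur a)) ?index_mem // nth_index.
Qed.

(** The list of [p] has no duplicates, so the prefix before [b] consists exactly of the agents
    ranked above [b]. *)
Lemma count_above cur (A2 : nat -> nat) (p : program I) (b : agent I) xs ys :
  (forall a, nth 0 inp (A2 (val a)) = val (cur a)) ->
  map val (prog_pref p) = xs ++ val b :: ys ->
  count (fun x => nth 0 inp (A2 x) == val p) xs = #|above cur p b|.
Proof.
move=> hA e; have uq : uniq (map val (prog_pref p)).
  by rewrite map_inj_uniq ?prog_pref_uniq //; apply: val_inj.
have ib : index b (prog_pref p) = size xs.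
  rewrite -(index_map val_inj) e index_cat.
  move: uq; rewrite e cat_uniq /= negb_or => /and3P [_ /andP [/negPf -> _] _].
  by rewrite eqxx addn0.
have le : size xs <= size (prog_pref p).
  by rewrite -(size_map val) e size_cat leq_addr.
have -> : xs = map val (take (size xs) (prog_pref p)).
  by rewrite map_take e take_size_cat.
rewrite count_map.
set l := take _ _; have ul : uniq l by rewrite take_uniq // prog_pref_uniq.
rewrite -size_filter -(card_uniqP (filter_uniq _ ul)); apply: eq_card => a.
rewrite mem_filter /= hA val_eqE mem_above; congr (_ && _).
by rewrite /l in_take_leq // /ranked_before ib.
Qed.

Definition seen cur i (xs : seq nat) (a : agent I) : bool :=
  (cur a < i) || (val (cur a) == i) && (val a \in xs).

(** The second alternative covers the time before any agent has been met, when register 8 is not yet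
    meaningful. *)
Definition heaviest cur (D : pred (agent I)) (s : state) : Prop :=
  (forall a, D a -> load cur a <= reg s 7) /\
  ((exists a : agent I, [/\ D a, reg s 8 = a & reg s 7 = load cur a]) \/
   (reg s 7 = 0 /\ forall a, ~~ D a)).

Lemma heaviest_ext cur D D' s : D =1 D' -> heaviest cur D s -> heaviest cur D' s.
Proof.
move=> e [h1 h2]; split=> [a|]; first by rewrite -e; apply: h1.
case: h2 => [[a [h3 h4 h5]]|[h3 h4]]; [left|right].
  by exists a; rewrite -e.
by split=> // a; rewrite -e.
Qed.

Lemma max_load_cmdP cur L1 g s : 0 < nA I -> acceptable cur -> rep cur L1 g s ->
  wp W max_load_cmd s (200 * input_size I) (fun s' =>
    exists a : agent I, [/\ reg s' 8 = a, reg s' 7 = load cur a &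
      forall b, load cur b <= load cur a]).
Proof.
move=> nA0 ca hs; have sz := size_ls_le; have WN := W_large1.
pose A2 := arr s 2.
have hA a : nth 0 inp (A2 (val a)) = val (cur a) by apply: rep_current ca hs.
pose cnt i xs := count (fun x => nth 0 inp (A2 x) == i) xs.
pose Out i s := arr s 2 = A2 /\ heaviest cur (fun a => cur a < i) s.
pose In i xs s := [/\ arr s 2 = A2, reg s 6 = cnt i xs & heaviest cur (seen cur i xs) s].
have lsP_size := size_prog_lists I.
apply: (@wp_leq _ _ _ (8 + (150 * size rest + 2 + 6)).+1).
  by move: sz; rewrite input_sizeE -/rest; lia.
apply: wp_seq.
apply: (@sp_wp W (Seq (Assign 7 (Cst 0)) (Seq (Assign 8 (Cst 0)) (Assign 1 (Reg 9))))) => /=.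
split; first by lia.
split; first by lia.
split=> //; rewrite /upd /=; set s0 := set_reg _ _ _.
have nth_lt i x : i < nB I -> x \in nth [::] (prog_lists I) i -> x < nA I.
  by move=> li; rewrite (nth_prog_lists (Ordinal li)) => /mapP [b _ ->]; apply: ltn_ord.
apply: (wp_weaken (wp_walk (inp := inp) (ls := prog_lists I) (rest := [::]) (Out := Out) (In := In)
  _ _ _ _ _ _ _ _ _ _ _ _ _ _)) => //.
- by rewrite size_inp; lia.
- by rewrite lsP_size; lia.
- by move=> i s1 r v; rewrite !inE => /or4P [] /eqP -> [].
- by move=> i xs s1 r v; rewrite !inE => /or4P [] /eqP -> [].
- by move=> s1 /= ->; rewrite lsP_size; split=> //; lia.
- move=> i s1 li _ [a2 h]; split; first by rewrite /=; lia.
  split=> //; apply: heaviest_ext h => a.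
  by rewrite /seen in_nil andbF orbF.
- move=> i xs x ys s1; rewrite lsP_size => li hl h3 h0 a1 [a2 h6 h].
  pose p : program I := Ordinal li.
  have hp : map val (prog_pref p) = xs ++ x :: ys by rewrite -nth_prog_lists.
  have xlt : x < nA I by apply: (nth_lt i) => //; rewrite hl mem_cat mem_head orbT.
  pose b : agent I := Ordinal xlt.
  have xb : x = val b by [].
  have ip : i = val p by [].
  have cb : cnt i xs = #|above cur p b|.
    by rewrite /cnt ip; apply: (@count_above cur A2 p b xs ys hA hp).
  have cle : cnt i xs < input_size I.
    rewrite cb; apply: (@leq_ltn_trans (nA I)); last by move: sz; rewrite size_agent_lists; lia.
    by apply: leq_trans (max_card _) _; rewrite card_ord.
  have seenE a : seen cur i (rcons xs x) a = seen cur i xs a || (cur a == p) && (a == b).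
    rewrite /seen mem_rcons inE -val_eqE -(val_eqE a) -ip -xb /=.
    by case: (val (cur a) == i); case: (val a == x); rewrite ?orbT ?orbF.
  have lb : cur b = p -> load cur b = (cnt i xs).+1 * nth 0 inp i.+2.
    by move=> e; rewrite /load e cb -encode_cost.
  have WP := W_prod i.+2 cle.
  rewrite /= /upd /= h0 h3 a1 a2 h6 !addn1 !addn2.
  have -> : nth 0 inp (A2 x) = val (cur b) by rewrite xb hA.
  have cnt1 : cnt i (rcons xs x) = cnt i xs + (val (cur b) == i).
    by rewrite /cnt -cats1 count_cat /= addn0 -hA.
  split=> //.
  + rewrite eqb0 negbK => /eqP e; have ecb : cur b = p by apply: val_inj.
    have lbE := lb ecb.
    split; first by do !split=> //; lia.
    split; first by do !split=> //; lia.
    * rewrite eqb0 negbK => lt; split; first by do !split=> //; lia.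
      split=> //; split=> //=; first by rewrite /upd /= cnt1 e eqxx addn1.
      case: h => h _; split=> /=; rewrite /upd /=.
        move=> a; rewrite seenE => /orP [/h|/andP [_ /eqP ->]]; last by rewrite lbE.
        by move=> h'; apply: leq_trans h' _; rewrite -ltnS.
      left; exists b; split=> //; rewrite ?lbE //.
      by rewrite seenE ecb !eqxx orbT.
    * move=> /eqP; rewrite eqb0 -leqNgt => le.
      split=> //=; first by rewrite /upd /= cnt1 e eqxx addn1.
      case: h => h h'; split=> /=; rewrite /upd /=.
        move=> a; rewrite seenE => /orP [/h //|/andP [_ /eqP ->]]; rewrite lbE; lia.
      case: h' => [[a [q1 q2 q3]]|[q1 q2]].
        by left; exists a; rewrite seenE q1.
      by exfalso; lia.
  + move=> /eqP; rewrite eqb0 => ne; split=> //; first by rewrite cnt1 (negPf ne) addn0.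
    apply: heaviest_ext h => a; rewrite seenE.
    have [->|] := eqVneq a b; rewrite ?andbF ?orbF //.
    by rewrite -val_eqE -ip (negPf ne) orbF.
- move=> i s1; rewrite lsP_size => li h0 [a2 h6 h] /=; split=> //.
  apply: heaviest_ext h => a; rewrite /seen [RHS]ltnS [RHS]leq_eqVlt [LHS]orbC.
  have [e|] //= := eqVneq (val (cur a)) i.
  (* By acceptability every agent at [p] is on the list of [p], so all of them have been met once it
     is exhausted. *)
  pose p : program I := Ordinal li; have ep : cur a = p by apply: val_inj.
  rewrite (nth_prog_lists p) mem_map; last exact: val_inj.
  by rewrite -pref_sym -ep ca.
- by rewrite /s0 /= (rep_input hs).
- by rewrite /s0 /= /upd /= (rep_lists hs) cats0.
- by split=> //; split=> //; right; split=> // a; rewrite ltn0.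
- by rewrite /= -/rest; lia.
- move=> s' [[_ [h1 h2]] _ _].
  case: h2 => [[a [_ q2 q3]]|[_ /(_ (Ordinal nA0))]]; last by rewrite lsP_size ltn_ord.
  exists a; split=> // b; rewrite -q3; apply: h1; rewrite lsP_size; exact: ltn_ord.
Qed.

Let load_word cur a : load cur a + 20 < W.
Proof.
rewrite /load -encode_cost; apply: W_prod.
apply: (@leq_ltn_trans (nA I)); last by move: size_ls_le; rewrite size_agent_lists; lia.
by apply: leq_trans (max_card _) _; rewrite card_ord.
Qed.

Lemma rep_frame cur L1 g c s s' : rep cur L1 g s -> frame c s s' ->
  5 \notin wregs c -> 9 \notin wregs c -> all (fun k => k \notin warrs c) [:: 0; 1; 2; 3] ->
  rep cur L1 g s'.
Proof.
move=> [h1 h2 h3 h4 h5 h6] [fr fa] n5 n9 /and5P [a0 a1 a2 a3 _].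
by split; rewrite ?fr ?fa.
Qed.

Lemma save_loopP cur s : arr s 0 = nth 0 inp ->
  (forall a : agent I, nth 0 inp (arr s 2 a) = cur a) ->
  wp W save_loop s (30 * input_size I) (fun s' => forall a : agent I, arr s' 1 a = cur a).
Proof.
move=> h0 hA; have sz := size_ls_le; rewrite size_agent_lists in sz.
have WN := W_large1; pose A2 := arr s 2.
pose Inv i s := [/\ arr s 0 = nth 0 inp, arr s 2 = A2 &
  forall a : agent I, a < i -> arr s 1 a = cur a].
apply: (wp_weaken (wp_for (n := nA I) (e := n_agents) (Inv := Inv)
  (T := fun=> ctime (Store 1 (Reg 0) (Get 0 (Get 2 (Reg 0))))) _ _ _ _ _ _ _)) => //.
- by lia.
- by lia.
- by move=> i s1 [a0 _ _]; apply: agents_ok.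
- move=> i s1 li hi [a0 a2 a1]; apply: sp_wp; split=> //=.
  split=> //= a; rewrite /upd /= hi a0 a2 ltnS leq_eqVlt => /orP [/eqP <-|lt].
    by rewrite eqxx hA.
  by rewrite (ltn_eqF lt); apply: a1.
- by rewrite sum_nat_const card_ord /=; lia.
- by move=> s' [_ _ h] a; apply: h.
Qed.

Lemma save_cmdP cur L1 g s a : acceptable cur -> rep cur L1 g s -> reg s 7 = load cur a ->
  L1 < W -> wp W save_cmd s (40 * input_size I) (fun s' =>
    if below L1 (load cur a) then rep cur (load cur a).+1 cur s' else rep cur L1 g s').
Proof.
move=> ca hs h7 hL; have sz := size_ls_le; have WN := W_large1.
have WV := load_word cur a.
apply: (@wp_leq _ _ _ (9 + (4 + 30 * input_size I).+1).+1); first by lia.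
apply: wp_if => /=; rewrite h7 (rep_threshold hs) addn1.
- by do !split=> //; lia.
- move=> nb; have bV : below L1 (load cur a).
    by move: nb; rewrite /below; case: (L1 == 0); case: (_ < _).
  rewrite bV; apply: wp_seq; apply: (@sp_wp W (Assign 5 _)) => /=; rewrite h7 addn1.
  split; first by do !split=> //; lia.
  set s1 := set_reg _ _ _.
  apply: wp_weaken (wp_frame (@save_loopP cur s1 _ _)) (leqnn _) _.
  + exact: rep_input hs.
  + by move=> b; apply: rep_current ca hs.
  move=> s2 [out [fr fa]]; have [q1 q2 q3 q4 q5 _] := hs.
  split; [by rewrite fa | by rewrite fr | by rewrite fr | | | by []] => b;
    rewrite fa //; [exact: q4 | exact: q5].
- move=> nb; have bV : ~~ below L1 (load cur a).
    by move: nb; rewrite /below; case: (L1 == 0); case: (_ < _).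
  rewrite (negPf bV); apply: (@wp_leq _ _ _ (ctime Skip)); first by rewrite /=; lia.
  exact: sp_wp.
Qed.

Lemma advance_cmdP cur L1 g s (a : agent I) : rep cur L1 g s -> reg s 8 = a ->
  acceptable cur ->
  wp W advance_cmd s 20 (fun s' =>
    if (index (cur a) (agent_pref a)).+1 == size (agent_pref a) then
      reg s' 4 != 0 /\ arr s' 1 = arr s 1
    else reg s' 4 = 0 /\ exists cur', [/\ rep cur' L1 g s',
      forall b, b != a -> cur' b = cur b, cur' a \in agent_pref a &
      index (cur' a) (agent_pref a) = (index (cur a) (agent_pref a)).+1]).
Proof.
move=> hs h8 ca; have sz := size_ls_le; have WN := W_large1.
have ilt : index (cur a) (agent_pref a) < size (agent_pref a) by rewrite index_mem.
have bs := base_size a; rewrite size_inp in bs.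
apply: (@wp_leq _ _ _ (ctime advance_cmd)) => //.
apply: sp_wp; rewrite /= /upd /= h8 (rep_pos hs) (rep_end hs) eqxx addn1.
split=> //; first by split=> //; lia.
split; first by do !split=> //; lia.
rewrite -addnS eqn_add2l; case: eqP => [e|/eqP ne]; first by [].
split=> //=.
have lt : (index (cur a) (agent_pref a)).+1 < size (agent_pref a) by rewrite ltn_neqAle ne.
set q := nth (cur a) (agent_pref a) (index (cur a) (agent_pref a)).+1.
exists (fun b => if b == a then q else cur b); rewrite eqxx.
have iq : index q (agent_pref a) = (index (cur a) (agent_pref a)).+1.
  by rewrite index_uniq // agent_pref_uniq.
split=> //; last by rewrite mem_nth.
  have [q1 q2 q3 q4 q5 q6] := hs; split=> //= b; rewrite /upd /=.
  have [->|ne'] := eqVneq b a; first by rewrite eqxx iq.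
  by rewrite val_eqE (negPf ne') q4.
by move=> b /negPf ->.
Qed.

(** * Rounds of the main loop and their number *)

Definition potential cur : nat :=
  \sum_(a : agent I) (size (agent_pref a) - index (cur a) (agent_pref a)).

Definition solved (s : state) : Prop := forall N : {set agent I * program I},
  feasible N -> feasible (output I s) /\
    total_cost (output I s) <= #|program I| * total_cost N.

Definition running (n : nat) (s : state) : Prop :=
  reg s 4 = 0 /\ exists cur L1 g,
    [/\ run cur L1 g, rep cur L1 g s, L1 < W & potential cur <= n].

Lemma round_cmdP n s : 0 < nA I -> running n.+1 s ->
  wp W round_cmd s (300 * input_size I) (fun s' =>
    running n s' \/ reg s' 4 != 0 /\ solved s').
Proof.
move=> nA0 [h4 [cur [L1 [g [hrun hs hL pot]]]]].
have sz := size_ls_le; have ca := run_acceptable hrun.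
apply: (@wp_leq _ _ _ (200 * input_size I + (40 * input_size I + 20).+1).+1); first by lia.
apply: wp_seq; apply: wp_weaken (wp_frame (max_load_cmdP nA0 ca hs)) (leqnn _) _.
move=> s1 [[a [h8 h7 amax]] f1].
have hs1 : rep cur L1 g s1 by apply: rep_frame hs f1 _ _ _.
apply: wp_seq; apply: wp_weaken (wp_frame (save_cmdP ca hs1 h7 hL)) (leqnn _) _.
move=> s2 [hsave [f2 _]].
have {}h8 : reg s2 8 = a by rewrite f2.
(* Saving lowers the threshold to the current maximum load. In either branch the heaviest agent is
   no longer below it, as [run_advance] and [run_final] require. *)
have [L1' [g' [hrun' hs2 hL' nb]]] : exists L1' g',
    [/\ run cur L1' g', rep cur L1' g' s2, L1' < W & ~~ below L1' (load cur a)].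
  move: hsave; case: ifP => [b|/negbT b] hs2.
    exists (load cur a).+1, cur; split=> //.
    - exact: run_save hrun amax b.
    - by have := load_word cur a; lia.
    - by rewrite /below ltnn.
  by exists L1, g; split.
apply: wp_weaken (advance_cmdP hs2 h8 ca) (leqnn _) _ => s3.
case: ifP => [/eqP last [h4' ar]|_ [h4' [cur' [hs3 same ina next]]]]; [right|left].
  split=> // N fN; rewrite (@outputE _ s3 g'); first exact: run_final hrun' nb last fN.
  move=> b; rewrite ar; apply: (rep_saved hs2).
  by apply: contraNneq nb => ->.
split=> //; exists cur', L1', g'; split=> //; first exact: run_advance hrun' nb same ina next.
rewrite -ltnS; apply: leq_trans pot; rewrite /potential (bigD1 a) //= [X in _ < X](bigD1 a) //=.
rewrite (eq_bigr (fun b => size (agent_pref b) - index (cur b) (agent_pref b))).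
  rewrite ltn_add2r next.
  have : index (cur a) (agent_pref a) < size (agent_pref a) by rewrite index_mem.
  lia.
by move=> b /same ->.
Qed.

(** Every round that continues uses up one list entry. The potential is never 0 during the run,
    since the current program of an agent is on its list. *)
Lemma rounds_cmdP n s : 0 < nA I -> running n s ->
  wp W (While (Bin Eq (Reg 4) (Cst 0)) round_cmd) s
    (n.+1 * (300 * input_size I + 10)) solved.
Proof.
move=> nA0; have WN := W_large1.
elim: n s => [|n IH] s hr.
  case: hr => _ [cur [L1 [g [hrun _ _]]]]; rewrite leqn0 sum_nat_eq0 => /forallP.
  move=> /(_ (Ordinal nA0)) /=; rewrite subn_eq0 leqNgt index_mem.
  by rewrite (run_acceptable hrun).
have [h4 _] := hr.
apply: (@wp_leq _ _ _ (3 + 300 * input_size I + n.+1 * (300 * input_size I + 10)).+1).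
  by rewrite [X in _ < X]mulSn; lia.
apply: wp_while_step => /=.
- by rewrite h4 eqxx; do !split=> //; lia.
- by rewrite h4.
apply: wp_weaken (round_cmdP nA0 hr) (leqnn _) _ => s1 [/IH //|[ne out]].
apply: (@wp_leq _ _ _ 4); first by rewrite mulSn; lia.
apply: wp_while_end => //=; first by do !split=> //; lia.
by rewrite (negPf ne).
Qed.

End PolynomialAlgorithm.

Lemma running_start I W s : 0 < nA I -> 0 < W -> start_spec I s -> reg s 4 = 0 ->
  running W (fun a : agent I => arr s 2 a) (input_size I) s.
Proof.
move=> nA0 W0 [a0 d9 r4 r5 hA] h4; split=> //.
have ne (a : agent I) : exists p, (p \in agent_pref a) && (index p (agent_pref a) == 0).
  have c0 : count (fun l => size l == 0) (agent_lists I) = 0 by move: r4; rewrite h4; lia.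
  have : nth [::] (agent_lists I) a \in agent_lists I.
    by rewrite mem_nth // size_agent_lists ltn_ord.
  move/eqP: c0; rewrite -leqn0 leqNgt -has_count => /hasPn /[apply].
  rewrite nth_agent_lists; case: (agent_pref a) => //= p l _.
  by exists p; rewrite inE !eqxx.
have [cur curP] := fin_all_exists ne.
have cur_in : acceptable cur by move=> a; case/andP: (curP a).
have cur0 a : index (cur a) (agent_pref a) = 0 by case/andP: (curP a) => _ /eqP.
exists cur, 0, cur; split=> //; first exact: run_start.
  split=> // a; last by case: (hA a).
  by rewrite cur0 addn0.
apply: (@leq_trans (size (flatten (map encl (agent_lists I))))); last first.
  by rewrite input_sizeE; lia.
rewrite size_flatten_encl size_agent_lists; apply: leq_sum => a _.
by rewrite nth_agent_lists size_map; apply: leq_trans (leq_subr _ _) (leqnSn _).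
Qed.

(** Either there is no agent, and the empty output is the only matching, or an empty list rules out
    feasible solutions. *)
Lemma solved_start I s : start_spec I s -> reg s 4 != 0 -> solved I s.
Proof.
move=> [_ _ r4 _ _] ne N fN; have [h [eN ha _]] := feasible_graphE fN.
move: ne; rewrite r4; case: (posnP (nA I)) => [nA0 _|nA0].
  have noagent (a : agent I) : False by have := ltn_ord a; move: (nA0); lia.
  rewrite (@outputE _ s h); last by move=> a; case: (noagent a).
  by rewrite -eN; split=> //; rewrite eN total_cost_graph sum_cost_fiber big1 //.
rewrite add0n -lt0n -has_count => /hasP [l /mapP [a _ ->]].
by rewrite size_map; move: (ha a); case: (agent_pref a).
Qed.

(** Quadratic time: linearly many rounds, each linear. *)
Lemma poly_cmdP I W : (input_size I + \max_(x <- encode I) x) ^ 2 + 20 < W ->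
  wp W poly_cmd (initial_state I) (1000 * input_size I ^ 2) (solved I).
Proof.
move=> hW; have N2 : 1 < input_size I by rewrite input_sizeE.
have W1 : 1 < W by lia.
apply: (@wp_leq _ _ _ (100 * input_size I +
   (input_size I).+1 * (300 * input_size I + 10)).+1).
  by rewrite -mulnn; nia.
apply: wp_seq; apply: wp_weaken (init_cmdP hW) (leqnn _) _ => s hs.
have [h4|ne] := eqVneq (reg s 4) 0; last first.
  apply: (@wp_leq _ _ _ 4); first by nia.
  apply: wp_while_end => /=; [by do !split=> //; lia|by rewrite (negPf ne)|].
  exact: solved_start.
have nA0 : 0 < nA I by case: hs => _ _ r4 _ _; move: r4; rewrite h4; lia.
have [_ _ _ _ hA] := hs.
(* The addresses left by the initialization are the starts of the lists and stay fixed from here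
   on. *)
pose base (a : agent I) := arr s 2 a.
apply: (@rounds_cmdP I W hW base) => //.
- move=> a; have [_ [t e]] := hA a; move: (congr1 size e).
  rewrite size_drop size_cat size_map /base.
  have : 0 < size (agent_pref a).
    have := running_start nA0 (ltnW W1) hs h4; case=> _ [cur [L1 [g [hr _ _ _]]]].
    by move: (run_acceptable hr a); case: (agent_pref a).
  move: (size (agent_pref a)) (size t) (size _) (arr s 2 a) => x y z v.
  lia.
- move=> a k lt; have [_ [t e]] := hA a.
  by rewrite -nth_drop e nth_cat size_map lt.
- exact: running_start (ltnW W1) hs h4.
Qed.

Lemma input_size_bits I : input_size I <= input_bits I.
Proof. by rewrite /input_size /input_bits -sum1_size; apply: leq_sum. Qed.

Lemma poly_time_part : has_poly_time_approximation (fun I : instance => #|program I|).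
Proof.
exists poly_cmd, 1000 => I.
have N2 : 1 < input_size I by rewrite input_sizeE.
have [t [s [ex le out]]] : wp (word_bound 1000 I) poly_cmd (initial_state I)
    (1000 * input_size I ^ 2) (solved I).
  apply: poly_cmdP; apply: leq_trans (word_bound_ge I (isT : 1 < 1000)).
  rewrite -mulnn; move: N2; set N := input_size I; move: (\max_(_ <- _) _) => m.
  by nia.
exists t, s; split=> //; last by move=> Mopt [fM _]; apply: out.
apply: leq_trans le _; rewrite leq_mul2l; apply/orP; right.
have bits := input_size_bits I.
apply: (@leq_trans (input_bits I ^ 2)); first by rewrite leq_exp2r.
by apply: leq_pexp2l => //; lia.
Qed.

Theorem theorem4 :
  has_linear_time_approximation max_prog_pref /\
  has_poly_time_approximation (fun I : instance => #|program I|).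
Proof. exact: (conj linear_time_part poly_time_part). Qed.
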